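(* In the setting of the context, let $0\le M\le 2s$ and let $y_1,\dots,y_{2s+1}$ be as in the context. Define for a $2s$-tuple $\bar u=(u_1,\dots,u_{2s})$ $$X^-_M(\bar u)=\mathcal G^-_{2s}(\bar u)F_M\sum_{M'=0}^{2s}Q_{MM'}\prod_{i=1}^{2s}\Big(U_i-\frac{r_0}{q+q^{-1}}\theta^\diamond_{M'}\Big),\qquad X^+_M(\bar u)=\mathcal G^+_{2s}(\bar u)\frac{\kappa F_M}{\nu^{[*,\diamond,\cdot]}}\sum_{M'=0}^{2s}\frac{Q_{MM'}}{H_{M'}}\prod_{i=1}^{2s}\Big(U_i-\frac{r_0}{q+q^{-1}}\theta^\diamond_{M'}\Big).$$ Then for $\epsilon\in\{+,-\}$ and every $j=1,\dots,2s+1$: $\sum_{k=1}^{2s+1}(L^\epsilon_{jk}-\delta_{jk}\theta_M)\,X^\epsilon_M(\bar{\mathcal Y}_k)=0$.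
   Context: $q\in\mathbb C^*$ not a root of unity, $s\in\{0,\tfrac12,1,\dots\}$; $b(x)=x-x^{-1}$; $(x;p)_n=\prod_{k=0}^{n-1}(1-xp^k)$, $(x_1,\dots,x_r;p)_n=\prod_i(x_i;p)_n$; ${}_4\phi_3\!\left({x_1,x_2,x_3,x_4\atop y_1,y_2,y_3}\right)=\sum_{n\ge0}\frac{(x_1,x_2,x_3,x_4;q^2)_n}{(q^2,y_1,y_2,y_3;q^2)_n}q^{2n}$. Labels $\{\cdot,*,\diamond\}$, $\mathsf b^\cdot=\mathsf b$, $\mathsf c^\cdot=\mathsf c$. Nonzero $r_0,\mathsf b^a,\mathsf c^a$ with $r_0^{-2}=\mathsf b\mathsf c=\mathsf b^*\mathsf c^*=\mathsf b^\diamond\mathsf c^\diamond$, chosen so that all denominators below are nonzero; $\theta^a_M=\mathsf b^aq^{2M}+\mathsf c^aq^{-2M}$, $\theta_M=\theta^\cdot_M$; $\omega^{\{a,b,c\}}=-(q-q^{-1})^2(\theta^a_s\theta^b_s-r_0^{-1}(q^{2s+1}+q^{-2s-1})\theta^c_s)$; $\rho=-\frac{(q^2-q^{-2})^2}{r_0^2}$, $\eta=\frac{q+q^{-1}}{r_0}\omega^{\{\cdot,\diamond,*\}}$, $\eta^*=\frac{q+q^{-1}}{r_0}\omega^{\{*,\diamond,\cdot\}}$. The numbers $y_1,\dots,y_{2s+1}\in\mathbb C^*$ satisfy $y_j^4\notin\{1,q^{-2},q^{-4}\}$ and $\frac{qy_j^2+q^{-1}y_j^{-2}}{q+q^{-1}}$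 pairwise distinct; $\bar{\mathcal Y}_k$ is $(y_1,\dots,y_{2s+1})$ with $y_k$ deleted. For $\bar u$: $U_i=\frac{qu_i^2+q^{-1}u_i^{-2}}{q+q^{-1}}$, $\mathcal G^\epsilon_n(\bar u)=(\epsilon(q+q^{-1})q^{-\epsilon(n+1)}\beta_\epsilon)^n\prod_ib(u_i^2)u_i^{-\epsilon}$ with $\beta_-=\mathsf b$, $\beta_+=\mathsf c^*$. Functions: $\zeta\in\mathbb C^*$ with $\zeta^{-2}=\mathsf b^\diamond r_0q^{2s}$; $\Lambda^\epsilon_1(u)=\frac{q^{-2s-1}}{u^\epsilon}(q^{2s+1}u\zeta^{-1}-u^{-1}\zeta)(q^{2s+1}u\zeta-u^{-1}\zeta^{-1})(u\mathsf c^*q^{-2s}+u^{-1}\mathsf bq^{2s})\big(u(\mathsf c/\mathsf c^* )^{\frac{1-\epsilon}2}+u^{-1}(\mathsf b^*/\mathsf b)^{\frac{1+\epsilon}2}\big)$, $\Lambda^\epsilon_2(u)=\frac{(u^2-u^{-2})q^{-2s-1}}{u^\epsilon(qu^2-q^{-1}u^{-2})}(q^{2s-1}u^{-1}\zeta-u\zeta^{-1})(q^{2s-1}u^{-1}\zeta^{-1}-u\zeta)(q^2u\mathsf bq^{2s}+u^{-1}\mathsf c^*q^{-2s})\big(q^2u(\mathsf b^*/\mathsf b)^{\frac{1+\epsilon}2}+u^{-1}(\mathsf c/\mathsf c^* )^{\frac{1-\epsilon}2}\big)$; $g(u,\bar u)=\prod_{u_i\in\bar u}(b(u/u_i)b(quu_i))^{-1}$;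 $Y_\epsilon(u|\bar u)=\frac{u^{2\epsilon+1}\Lambda^\epsilon_1(u)}{b(u^2)b(qu^2)}\prod_{u_i\in\bar u}b(u/(qu_i))b(uu_i)+\frac{q^{-\epsilon-1}u^{-1}\Lambda^\epsilon_2(u)}{b(u^2)b(q^2u^2)}\prod_{u_i\in\bar u}b(qu/u_i)b(q^2uu_i)-\delta_{\epsilon,+}q^{-1-4s}\mathsf c^*\prod_{j=0}^{2s}b(q^{1/2+j-s}u\zeta)b(q^{1/2+j-s}u\zeta^{-1})$; $L^\epsilon_{jk}=\big(\frac{y_j}{y_k}\big)^{\epsilon}\frac{b(y_k^2)}{b(y_j^2)}g(y_k,\bar{\mathcal Y}_k)Y_\epsilon(y_k|\bar{\mathcal Y}_j)+\delta_{jk}\frac{(q+q^{-1})^2}{\rho b(y_j^2)b(q^2y_j^2)}\big(\eta^*+\eta\frac{qy_j^2+q^{-1}y_j^{-2}}{q+q^{-1}}\big)$. Constants: $F_M=\prod_{k=0}^{M-1}\frac{\mathsf cq^{-2k-2}+r_0q^{-1}\mathsf c^*\mathsf b^\diamond}{\mathsf bq^{2k}+r_0q^{-1}\mathsf c^*\mathsf b^\diamond}$, $H_M=\prod_{k=0}^{M-1}q^{4k}\frac{\mathsf b^\diamond}{\mathsf c^\diamond}\frac{\mathsf c^\diamond q^{-2k}+r_0q\mathsf c^*\mathsf b}{\mathsf b^\diamond q^{2k}+r_0q^{-1}\mathsf c^*\mathsf b}$, $\kappa=(-1)^{2s}q^{2s(2s-1)}\frac{(q^2r_0^2\mathsf b^2,q^2r_0^2(\mathsf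 b^\diamond)^2,q^2r_0^2(\mathsf b^* )^2;q^2)_{2s}}{(-\frac{qr_0\mathsf b\mathsf b^\diamond}{\mathsf b^*},-\frac{qr_0\mathsf b\mathsf b^*}{\mathsf b^\diamond},-\frac{qr_0\mathsf b^\diamond\mathsf b^*}{\mathsf b};q^2)_{2s}}$. For a triple $(x,y,z)$ of distinct labels: $R^{[x,z]}_M(\theta^y_N)={}_4\phi_3\!\left({q^{-2M},\frac{\mathsf b^x}{\mathsf c^x}q^{2M},q^{-2N},\frac{\mathsf b^y}{\mathsf c^y}q^{2N}\atop -\frac{\mathsf b^x\mathsf c^z}{\mathsf c^y}r_0q,\,-\frac{\mathsf b^y\mathsf b^z}{\mathsf c^x}r_0q^{4s+1},\,q^{-4s}}\right)$, $\tilde k^{[x,y,z]}_M=\frac{(-\frac{\mathsf b^x\mathsf c^z}{\mathsf c^y}r_0q,-\frac{\mathsf b^y\mathsf b^z}{\mathsf c^x}r_0q^{4s+1},\frac{\mathsf b^x}{\mathsf c^x},q^{-4s};q^2)_M}{(q^2,-\frac{\mathsf b^x\mathsf c^z}{\mathsf b^y}r_0q^{1-4s},-\frac{\mathsf c^y\mathsf b^z}{\mathsf c^x}r_0q,\frac{\mathsf b^x}{\mathsf c^x}q^{4s+2};q^2)_M}\frac{1-\frac{\mathsf b^x}{\mathsf c^x}q^{4M}}{(\mathsf b^y/\mathsf c^y)^M(1-\mathsf b^x/\mathsf c^x)}$, $\nu^{[x,y,z]}=\frac{(\frac{\mathsf b^x}{\mathsf c^x}q^2,\frac{\mathsf b^y}{\mathsf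 c^y}q^2;q^2)_{2s}}{(-\frac{\mathsf b^y\mathsf b^z}{\mathsf c^x}r_0q^{4s+1})^{2s}(-\frac{\mathsf b^x\mathsf c^z}{\mathsf b^y}r_0q^{1-4s},-\frac{\mathsf c^x\mathsf c^z}{\mathsf c^y}r_0q^{1-4s};q^2)_{2s}}$, and $Q_{MM'}=(\nu^{[\diamond,\cdot,*]})^{-1}\tilde k^{[\diamond,\cdot,*]}_{M'}R^{[\diamond,*]}_{M'}(\theta_M)$. Standing assumption: there exist $A,A^*\in\mathrm{End}(\mathbb C^{2s+1})$ satisfying, with $A^\diamond=\frac{r_0}{q^2-q^{-2}}(qA^*A-q^{-1}AA^* )+\frac{r_0\omega^{\{\cdot,*,\diamond\}}}{(q-q^{-1})(q^2-q^{-2})}\mathbb I$, the relations $[A^a,[A^a,A^b]_q]_{q^{-1}}=-\frac{(q^2-q^{-2})^2}{r_0^2}A^b+\omega^{\{a,b,c\}}A^a+\frac{q+q^{-1}}{r_0}\omega^{\{a,c,b\}}\mathbb I$ for all ordered pairs $(a,b)$ of distinct labels ($c$ the third, $A^\cdot=A$, $[X,Y]_q=qXY-q^{-1}YX$), such that $(A,A^* )$, $(A^*,A^\diamond)$, $(A^\diamond,A)$ are Leonard pairs (each diagonalizable, irreducible tridiagonal in an eigenbasis of the other) with eigenvalue orderings $\theta_M,\theta^*_M,\theta^\diamond_M$. *)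

(* Defs.v *)
From HB Require Import structures.
From mathcomp Require Import all_boot all_algebra.
From mathcomp Require Import reals complex.
Unset Printing Implicit Defensive.
Import GRing.Theory Num.Theory.
Local Open Scope ring_scope.

Inductive lab := LDot | LStar | LDia.

Definition third (a b : lab) : lab :=
  match a, b with
  | LDot, LStar | LStar, LDot => LDia
  | LDot, LDia | LDia, LDot => LStar
  | LStar, LDia | LDia, LStar => LDot
  | _, _ => a
  end.

(* Parameters of the setting.  qh is a square root of q (q = qh^2), used to
   write q^(1/2 + j - s); two_s = 2s; bl a = b^a, cl a = c^a. *)
Record params (C : Type) := Params {
  qh : C; two_s : nat; r0 : C; bl : lab -> C; cl : lab -> C; zeta : C }.
Arguments qh {C}. Arguments two_s {C}. Arguments r0 {C}.
Arguments bl {C}. Arguments cl {C}. Arguments zeta {C}.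

Section Defs.
Context {C : fieldType}.
Variable P : params C.

Definition q : C := qh P ^+ 2.
Local Notation N := (two_s P).
Local Notation Ni := (Posz (two_s P)).
Local Notation q2 := (q ^+ 2).

Definition bb (x : C) : C := x - x^-1.

Definition qpoch (x p : C) (n : nat) : C := \prod_(k < n) (1 - x * p ^+ k).

Definition thetak (a : lab) (k : int) : C := bl P a * q ^ k + cl P a * q ^ (- k).
Definition theta (a : lab) (M : nat) : C := thetak a (2 * M)%N.
Definition theta_s (a : lab) : C := thetak a Ni.

Definition omega (a b c : lab) : C :=
  - (q - q^-1) ^+ 2 *
    (theta_s a * theta_s b - (r0 P)^-1 * (q ^ (Ni + 1) + q ^ (- (Ni + 1))) * theta_s c).

Definition rho : C := - (q ^+ 2 - q ^- 2) ^+ 2 / (r0 P) ^+ 2.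
Definition eta : C := (q + q^-1) / r0 P * omega LDot LDia LStar.
Definition etas : C := (q + q^-1) / r0 P * omega LStar LDia LDot.

Definition UU (u : C) : C := (q * u ^+ 2 + q^-1 * u ^- 2) / (q + q^-1).

Definition sgn (e : bool) : int := if e then 1 else -1.

Definition GG (e : bool) (n : nat) (ub : seq C) : C :=
  ((sgn e)%:~R * (q + q^-1) * q ^ (- (sgn e * (n%:Z + 1))) *
     (if e then cl P LStar else bl P LDot)) ^+ n *
  \prod_(u <- ub) (bb (u ^+ 2) * u ^ (- sgn e)).

Definition Lambda1 (e : bool) (u : C) : C :=
  let z := zeta P in
  q ^ (- (Ni + 1)) / u ^ (sgn e) *
  (q ^ (Ni + 1) * u * z^-1 - u^-1 * z) *
  (q ^ (Ni + 1) * u * z - u^-1 * z^-1) *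
  (u * cl P LStar * q ^ (- Ni) + u^-1 * bl P LDot * q ^ Ni) *
  (u * (if e then 1 else cl P LDot / cl P LStar) +
   u^-1 * (if e then bl P LStar / bl P LDot else 1)).

Definition Lambda2 (e : bool) (u : C) : C :=
  let z := zeta P in
  (u ^+ 2 - u ^- 2) * q ^ (- (Ni + 1)) / (u ^ (sgn e) * (q * u ^+ 2 - q^-1 * u ^- 2)) *
  (q ^ (Ni - 1) * u^-1 * z - u * z^-1) *
  (q ^ (Ni - 1) * u^-1 * z^-1 - u * z) *
  (q ^+ 2 * u * bl P LDot * q ^ Ni + u^-1 * cl P LStar * q ^ (- Ni)) *
  (q ^+ 2 * u * (if e then bl P LStar / bl P LDot else 1) +
   u^-1 * (if e then 1 else cl P LDot / cl P LStar)).

Definition gg (u : C) (ub : seq C) : C :=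
  \prod_(v <- ub) (bb (u / v) * bb (q * u * v))^-1.

Definition YY (e : bool) (u : C) (ub : seq C) : C :=
  u ^ (2 * sgn e + 1) * Lambda1 e u / (bb (u ^+ 2) * bb (q * u ^+ 2)) *
    \prod_(v <- ub) (bb (u / (q * v)) * bb (u * v))
  + q ^ (- sgn e - 1) * u^-1 * Lambda2 e u / (bb (u ^+ 2) * bb (q ^+ 2 * u ^+ 2)) *
    \prod_(v <- ub) (bb (q * u / v) * bb (q ^+ 2 * u * v))
  - (if e then 1 else 0) * q ^ (- 1 - 2 * Ni) * cl P LStar *
    \prod_(j < N.+1) (bb (qh P ^ (1 + 2 * j%:Z - Ni) * u * zeta P) *
                      bb (qh P ^ (1 + 2 * j%:Z - Ni) * u * (zeta P)^-1)).

Definition Ybar (y : 'I_N.+1 -> C) (k : 'I_N.+1) : seq C :=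
  [seq y i | i <- enum 'I_N.+1 & i != k].

Definition LL (e : bool) (y : 'I_N.+1 -> C) (j k : 'I_N.+1) : C :=
  (y j / y k) ^ (sgn e) * bb (y k ^+ 2) / bb (y j ^+ 2) *
    gg (y k) (Ybar y k) * YY e (y k) (Ybar y j)
  + (j == k)%:R * ((q + q^-1) ^+ 2 / (rho * bb (y j ^+ 2) * bb (q ^+ 2 * y j ^+ 2)) *
                   (etas + eta * UU (y j))).

Definition FF (M : nat) : C :=
  \prod_(k < M) ((cl P LDot * q ^ (- (2 * k%:Z) - 2) + r0 P * q^-1 * cl P LStar * bl P LDia) /
                 (bl P LDot * q ^+ (2 * k) + r0 P * q^-1 * cl P LStar * bl P LDia)).

Definition HH (M : nat) : C :=
  \prod_(k < M) (q ^+ (4 * k) * (bl P LDia / cl P LDia) *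
                 ((cl P LDia * q ^ (- (2 * k%:Z)) + r0 P * q * cl P LStar * bl P LDot) /
                  (bl P LDia * q ^+ (2 * k) + r0 P * q^-1 * cl P LStar * bl P LDot))).

Definition kappa : C :=
  let b := bl P LDot in let bd := bl P LDia in let bs := bl P LStar in let r := r0 P in
  (-1) ^+ N * q ^+ (N * (N - 1)) *
  (qpoch (q ^+ 2 * r ^+ 2 * b ^+ 2) q2 N * qpoch (q ^+ 2 * r ^+ 2 * bd ^+ 2) q2 N *
   qpoch (q ^+ 2 * r ^+ 2 * bs ^+ 2) q2 N) /
  (qpoch (- (q * r * b * bd / bs)) q2 N * qpoch (- (q * r * b * bs / bd)) q2 N *
   qpoch (- (q * r * bd * bs / b)) q2 N).

(* terminating balanced 4phi3 series; since the first upper parameter is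
   q^{-2M} with M <= 2s, all terms with n > 2s vanish, so the sum is
   taken over n = 0..2s *)
Definition phi43 (x1 x2 x3 x4 y1 y2 y3 : C) : C :=
  \sum_(n < N.+1)
    (qpoch x1 q2 n * qpoch x2 q2 n * qpoch x3 q2 n * qpoch x4 q2 n) /
    (qpoch q2 q2 n * qpoch y1 q2 n * qpoch y2 q2 n * qpoch y3 q2 n) * q ^+ (2 * n).

(* lower parameters of R^{[x,z]} (with y the third label) *)
Definition Rlow1 (x y z : lab) : C := - (bl P x * cl P z / cl P y) * r0 P * q.
Definition Rlow2 (x y z : lab) : C := - (bl P y * bl P z / cl P x) * r0 P * q ^ (2 * Ni + 1).

Definition RR (x y z : lab) (M Nn : nat) : C :=
  phi43 (q ^ (- (2 * M%:Z))) (bl P x / cl P x * q ^+ (2 * M))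
        (q ^ (- (2 * Nn%:Z))) (bl P y / cl P y * q ^+ (2 * Nn))
        (Rlow1 x y z) (Rlow2 x y z) (q ^ (- (2 * Ni))).

Definition ktilde (x y z : lab) (M : nat) : C :=
  (qpoch (Rlow1 x y z) q2 M * qpoch (Rlow2 x y z) q2 M *
   qpoch (bl P x / cl P x) q2 M * qpoch (q ^ (- (2 * Ni))) q2 M) /
  (qpoch q2 q2 M * qpoch (- (bl P x * cl P z / bl P y) * r0 P * q ^ (1 - 2 * Ni)) q2 M *
   qpoch (- (cl P y * bl P z / cl P x) * r0 P * q) q2 M *
   qpoch (bl P x / cl P x * q ^ (2 * Ni + 2)) q2 M) *
  ((1 - bl P x / cl P x * q ^+ (4 * M)) /
   ((bl P y / cl P y) ^+ M * (1 - bl P x / cl P x))).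

Definition nu (x y z : lab) : C :=
  (qpoch (bl P x / cl P x * q ^+ 2) q2 N * qpoch (bl P y / cl P y * q ^+ 2) q2 N) /
  ((Rlow2 x y z) ^+ N *
   qpoch (- (bl P x * cl P z / bl P y) * r0 P * q ^ (1 - 2 * Ni)) q2 N *
   qpoch (- (cl P x * cl P z / cl P y) * r0 P * q ^ (1 - 2 * Ni)) q2 N).

Definition QQ (M M' : nat) : C :=
  (nu LDia LDot LStar)^-1 * ktilde LDia LDot LStar M' * RR LDia LDot LStar M' M.

Definition prodU (ub : seq C) (M' : nat) : C :=
  \prod_(u <- ub) (UU u - r0 P / (q + q^-1) * theta LDia M').

Definition XX (e : bool) (M : nat) (ub : seq C) : C :=
  if e then
    GG true N ub * (kappa * FF M / nu LStar LDia LDot) *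
      \sum_(M' < N.+1) (QQ M M' / HH M' * prodU ub M')
  else
    GG false N ub * FF M * \sum_(M' < N.+1) (QQ M M' * prodU ub M').

Definition qcomm (x : C) (X Y : 'M[C]_N.+1) : 'M[C]_N.+1 := x *: (X *m Y) - x^-1 *: (Y *m X).

Definition Amat (A As : 'M[C]_N.+1) (a : lab) : 'M[C]_N.+1 :=
  match a with
  | LDot => A
  | LStar => As
  | LDia => (r0 P / (q ^+ 2 - q ^- 2)) *: qcomm q As A +
           (r0 P * omega LDot LStar LDia / ((q - q^-1) * (q ^+ 2 - q ^- 2))) *: 1%:M
  end.

Definition irred_tridiag {n} (X : 'M[C]_n) : Prop :=
  forall i j : 'I_n,
    ((i.+1 < j)%N \/ (j.+1 < i)%N -> X i j = 0) /\
    ((i.+1 == j)%N || (j.+1 == i)%N -> X i j != 0).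

Definition leonard_pair {n} (X Y : 'M[C]_n) (thX thY : 'I_n -> C) : Prop :=
  (exists Pm : 'M[C]_n, Pm \in unitmx /\
     invmx Pm *m X *m Pm = diag_mx (\row_i thX i) /\ irred_tridiag (invmx Pm *m Y *m Pm)) /\
  (exists Pm : 'M[C]_n, Pm \in unitmx /\
     invmx Pm *m Y *m Pm = diag_mx (\row_i thY i) /\ irred_tridiag (invmx Pm *m X *m Pm)).

Definition standing_assumption : Prop :=
  exists A As : 'M[C]_N.+1,
    (forall a b : lab, a <> b ->
       qcomm (q^-1) (Amat A As a) (qcomm q (Amat A As a) (Amat A As b)) =
         rho *: Amat A As b + omega a b (third a b) *: Amat A As a +
         ((q + q^-1) / r0 P * omega a (third a b) b) *: 1%:M) /\
    leonard_pair (Amat A As LDot) (Amat A As LStar)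
      (fun M => theta LDot M) (fun M => theta LStar M) /\
    leonard_pair (Amat A As LStar) (Amat A As LDia)
      (fun M => theta LStar M) (fun M => theta LDia M) /\
    leonard_pair (Amat A As LDia) (Amat A As LDot)
      (fun M => theta LDia M) (fun M => theta LDot M).

Definition denominators_nonzero : Prop :=
  let b := bl P LDot in let bd := bl P LDia in let bs := bl P LStar in
  let cd := cl P LDia in let cs := cl P LStar in let r := r0 P in
  (* F_M and H_M *)
  (forall k : nat, (k < N)%N ->
     [/\ b * q ^+ (2 * k) + r * q^-1 * cs * bd != 0,
         bd * q ^+ (2 * k) + r * q^-1 * cs * b != 0 &
         cd * q ^ (- (2 * k%:Z)) + r * q * cs * b != 0]) /\
  (* kappa *)
  qpoch (- (q * r * b * bd / bs)) q2 N * qpoch (- (q * r * b * bs / bd)) q2 N *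
    qpoch (- (q * r * bd * bs / b)) q2 N != 0 /\
  (* nu^{[<>,.,*]} and nu^{[*,<>,.]} (denominators and the values themselves) *)
  (forall x y z, (x, y, z) = (LDia, LDot, LStar) \/ (x, y, z) = (LStar, LDia, LDot) ->
     qpoch (- (bl P x * cl P z / bl P y) * r * q ^ (1 - 2 * Ni)) q2 N *
     qpoch (- (cl P x * cl P z / cl P y) * r * q ^ (1 - 2 * Ni)) q2 N != 0 /\
     nu x y z != 0) /\
  (* ktilde^{[<>,.,*]}_{M'} for M' <= 2s *)
  qpoch (- (bd * cs / b) * r * q ^ (1 - 2 * Ni)) q2 N *
    qpoch (- (cl P LDot * bs / cd) * r * q) q2 N *
    qpoch (bd / cd * q ^ (2 * Ni + 2)) q2 N * (1 - bd / cd) != 0 /\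
  (* 4phi3 defining R^{[<>,*]}(theta_M) *)
  qpoch (Rlow1 LDia LDot LStar) q2 N * qpoch (Rlow2 LDia LDot LStar) q2 N != 0.

End Defs.

(* Main.v *)
(** Put [t = q u^2] and [X(t) = t + 1/t], so that [U_u = X(t) / (q + 1/q)], and
    let [w_j] be the monic polynomial with roots [X(q y_i^2)], [i <> j].  Up to a
    common factor and the conjugation by [b(y_k^2) y_k^(-epsilon)], the entry
    [L_jk] is the Lagrange weight at the node [X(q y_k^2)] times the value there
    of an Askey-Wilson difference operator (in base [p = q^2]) applied to [w_j];
    the diagonal term of [L] is the multiplication part of that operator, and for
    [epsilon = +] the subtracted product keeps the degree at [2s].  By Lagrange
    interpolation the sum over [k] is the value of the transformed [w_j] at the
    points [X(t_m)], [t_m = b^<> r0 p^m].  The operator acts tridiagonally on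
    this grid, and [m |-> ktilde_m R_m(theta_M)] is a left eigenvector of it,
    since [R] is an Askey-Wilson polynomial and [ktilde] is the weight that
    symmetrizes the operator.  The operator for [epsilon = +] is conjugate to the
    one for [epsilon = -] on the grid, by the diagonal matrix [H]. *)
Require Import Defs.
From HB Require Import structures.
From mathcomp Require Import all_boot all_algebra.
From mathcomp Require Import reals complex.
From mathcomp Require Import ring zify.
Import GRing.Theory Num.Theory.
Local Open Scope ring_scope.

(** * The Askey-Wilson operator and its action on a grid *)

Section AskeyWilson.
Context {F : fieldType}.
Variables (p c t0 g3 g4 : F) (N : nat).
Hypotheses (p0 : p != 0) (t00 : t0 != 0).

Definition joukowsky (t : F) : F := t + t^-1.

Definition aw_b : F := c * g3 * g4 / (p * p ^+ N).

(** The Askey-Wilson coefficient in base [p], scaled by [c], with parameters [t0], [1/(p^N t0)],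
    [g3], [g4]. The first two have product [p^-N], so that the grid [t0 p^m] stops at [m = N];
    [aw_b] is [c] times the product of all four over [p]. *)
Definition aw_coef (t : F) : F :=
  c * (1 - t / (p ^+ N * t0)) * (1 - t * t0) * (1 - t * g3) * (1 - t * g4) /
  ((1 - t ^+ 2) * (1 - p * t ^+ 2)).

(* [aw_coef + aw_extra] is [aw_coef] with the factor [1 - t g4] replaced by
   [1 - g4 / (p t)]; see [aw_coef_extra]. *)
Definition aw_extra (t : F) : F :=
  - (c * g4 / p) * (1 - t / (p ^+ N * t0)) * (1 - t * t0) * (1 - t * g3) /
  (t * (1 - t ^+ 2)).

Definition aw_eig (n : nat) : F := aw_b * p ^+ n + c / p ^+ n.

(** The shifted factorial [(t0 t, t0/t; p)_n]; on this basis the operator for [e = false] is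
    bidiagonal. *)
Definition psi (n : nat) (t : F) : F :=
  \prod_(k < n) ((1 - t0 * t * p ^+ k) * (1 - t0 * p ^+ k / t)).

Definition aw_low (n : nat) : F :=
  - (c / p ^+ n.+1 * (1 - p ^+ n.+1) * (1 - t0 * g4 * p ^+ n) *
     (1 - t0 * g3 * p ^+ n) * (1 - p ^+ n / p ^+ N)).

(** A difference term of [opAW] at [psi n.+1] after cancelling [1 - p t^2], hence meaningful also
    where that factor vanishes. *)
Definition aw_diff (n : nat) (t : F) : F :=
  - (psi n t * (1 - t0 * t * p ^+ n) * c * t0 * (1 - p ^+ n.+1) *
     (1 - t / (p ^+ N * t0)) * (1 - t * g3) * (1 - t * g4)) / (p * t * (1 - t ^+ 2)).

Definition opAW (e : bool) (f : F -> F) (t : F) : F :=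
  aw_coef t * (f (p * t) - f t) + aw_coef t^-1 * (f (p * t^-1) - f t) + aw_eig 0 * f t +
  (if e then aw_extra t * f (p * t) + aw_extra t^-1 * f (p * t^-1) else 0).

(* At the ends [t = t0] and [t = p^N t0] of the grid, one coefficient of [opAW]
   has a vanishing numerator, so that its value is right even where its denominator
   vanishes too (x / 0 = 0). *)
Definition generic (t : F) : bool :=
  [&& t != 0, 1 - t ^+ 2 != 0, (1 - p * t ^+ 2 != 0) || (t == p ^+ N * t0)
    & (1 - p * t^-1 ^+ 2 != 0) || (t == t0)].

(** * Action on the basis [psi] *)

Let pX0 n : p ^+ n != 0. Proof. exact: expf_neq0. Qed.

Lemma psiS n t : psi n.+1 t = psi n t * ((1 - t0 * t * p ^+ n) * (1 - t0 * p ^+ n / t)).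
Proof. by rewrite /psi big_ord_recr. Qed.

Lemma psiV n t : psi n t^-1 = psi n t.
Proof. by apply: eq_bigr => k _; rewrite invrK mulrC; congr (_ * _); rewrite mulrAC. Qed.

Lemma psi_shift n t : t != 0 ->
  psi n.+1 (p * t) * (1 - t0 * t) =
  psi n t * (1 - t0 * t * p ^+ n) * (1 - t0 * t * p ^+ n.+1) * (1 - t0 / (p * t)).
Proof.
move=> t_0; elim: n => [|n IH].
  by rewrite psiS /psi !big_ord0 !expr1 !expr0; field; rewrite p0 t_0.
rewrite psiS mulrAC IH psiS [p ^+ n.+2]exprS [p ^+ n.+1]exprS.
by field; rewrite p0 t_0.
Qed.

Lemma sqrV_neq1 (t : F) : t != 0 -> 1 - t ^+ 2 != 0 -> 1 - t^-1 ^+ 2 != 0.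
Proof.
move=> t_0; apply: contraNneq => /eqP; rewrite subr_eq0 exprVn eq_sym => /eqP h.
by rewrite -[t ^+ 2]invrK h invr1 subrr.
Qed.

(** If [1 - p t^2 = 0], either remaining alternative makes a numerator factor vanish on both
    sides. *)
Lemma aw_diffE n t : t != 0 -> 1 - t ^+ 2 != 0 ->
    (1 - p * t ^+ 2 != 0) || (1 - t / (p ^+ N * t0) == 0) || (1 - t0 * t == 0) ->
  aw_coef t * (psi n.+1 (p * t) - psi n.+1 t) = aw_diff n t.
Proof.
move=> t_0 h1 /orP[/orP[h2|/eqP h2]|/eqP h2].
- have -> : aw_coef t * (psi n.+1 (p * t) - psi n.+1 t) =
    c * (1 - t / (p ^+ N * t0)) * (1 - t * g3) * (1 - t * g4) /
    ((1 - t ^+ 2) * (1 - p * t ^+ 2)) *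
    (psi n.+1 (p * t) * (1 - t0 * t) - psi n.+1 t * (1 - t0 * t)).
    by rewrite /aw_coef [t * t0]mulrC; ring.
  rewrite psi_shift // psiS /aw_diff [p ^+ n.+1]exprS.
  by field; rewrite ?pX0 ?t_0 ?h1 ?h2 ?t00 ?p0.
- by rewrite /aw_coef /aw_diff h2 !(mulr0, mul0r, oppr0).
(* The factor [1 - t0 t] is the first one in [psi n t], or, for [n = 0], the one standing outside
   it. *)
have psi0 : psi n t * (1 - t0 * t * p ^+ n) = 0.
  case: n => [|n]; first by rewrite expr0 mulr1 h2 mulr0.
  by rewrite /psi big_ord_recl expr0 mulr1 h2 !mul0r.
by rewrite /aw_coef /aw_diff psi0 [t * t0]mulrC h2 !(mulr0, mul0r, oppr0).
Qed.

(** The poles at [t^2 = 1] cancel in the symmetrization [t <-> 1/t], leaving [psi n] times an affine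
    function of [X(t)]. *)
Lemma aw_diff_sum n t : t != 0 -> 1 - t ^+ 2 != 0 ->
  aw_diff n t + aw_diff n t^-1 = (aw_eig n.+1 - aw_eig 0) * psi n.+1 t + aw_low n * psi n t.
Proof.
move=> t_0 h1.
have h2 := sqrV_neq1 t t_0 h1.
have h3 : t ^+ 2 - 1 != 0 by rewrite -opprB oppr_eq0.
rewrite /aw_diff psiV psiS /aw_low /aw_eig /aw_b expr0 [p ^+ n.+1]exprS.
by field; rewrite ?pX0 ?t_0 ?h1 ?h2 ?t00 ?p0 ?h3 ?oner_neq0.
Qed.

Lemma generic_neq0 t : generic t -> t != 0. Proof. by case/and4P. Qed.
Lemma generic_sqr t : generic t -> 1 - t ^+ 2 != 0. Proof. by case/and4P. Qed.
Lemma generic_diff t n : generic t ->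
  aw_coef t * (psi n.+1 (p * t) - psi n.+1 t) = aw_diff n t /\
  aw_coef t^-1 * (psi n.+1 (p * t^-1) - psi n.+1 t) = aw_diff n t^-1.
Proof.
case/and4P=> t_0 h1 h2 h3; split.
  apply: aw_diffE => //; case/orP: h2 => [->//|/eqP ->].
  by rewrite divff ?subrr ?eqxx ?orbT // mulf_neq0.
rewrite -[psi n.+1 t]psiV; apply: aw_diffE; rewrite ?invr_eq0 ?sqrV_neq1 //.
by case/orP: h3 => [->//|/eqP ->]; rewrite divff // subrr eqxx !orbT.
Qed.

Lemma opAW_psi0 t : opAW false (psi 0) t = aw_eig 0.
Proof. by rewrite /opAW /psi !big_ord0 !subrr !mulr0 !add0r mulr1 addr0. Qed.

Lemma opAW_psiS n t : generic t ->
  opAW false (psi n.+1) t = aw_eig n.+1 * psi n.+1 t + aw_low n * psi n t.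
Proof.
move=> gt; have [e1 e2] := generic_diff t n gt.
rewrite /opAW /= e1 e2 (aw_diff_sum _ _ (generic_neq0 t gt) (generic_sqr t gt)); ring.
Qed.

Lemma aw_extra_psi0 t : t != 0 -> 1 - t ^+ 2 != 0 ->
  aw_extra t + aw_extra t^-1 =
  - (c * g4 / p) * (joukowsky t - ((p ^+ N * t0)^-1 + t0 + g3) + g3 / p ^+ N).
Proof.
move=> t_0 h1.
have h2 := sqrV_neq1 t t_0 h1.
have h3 : t ^+ 2 - 1 != 0 by rewrite -opprB oppr_eq0.
rewrite /aw_extra /joukowsky.
by field; rewrite ?pX0 ?t_0 ?h1 ?h2 ?t00 ?p0 ?h3 ?oner_neq0.
Qed.

Lemma aw_extra_psi_shift n t : t != 0 ->
  aw_extra t * psi n.+1 (p * t) = - (c * g4 / p) * (1 - t / (p ^+ N * t0)) * (1 - t * g3) /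
  (t * (1 - t ^+ 2)) *
  (psi n t * (1 - t0 * t * p ^+ n) * (1 - t0 * t * p ^+ n.+1) * (1 - t0 / (p * t))).
Proof. by move=> t_0; rewrite -psi_shift // /aw_extra [t * t0]mulrC; ring. Qed.

(** The extra part raises the degree in [X(t)] by one; only the top coefficient has to be known
    explicitly. *)
Lemma aw_extra_psiS n : exists B G, forall t, t != 0 -> 1 - t ^+ 2 != 0 ->
  aw_extra t * psi n.+1 (p * t) + aw_extra t^-1 * psi n.+1 (p * t^-1) =
  psi n t * (c * g4 * t0 / p ^+ 2 * joukowsky t ^+ 2 + B * joukowsky t + G).
Proof.
set s1 := (p ^+ N * t0)^-1; set s3 := t0 * p ^+ n; set s4 := t0 * p ^+ n.+1.
set ta := t0 / p; set k := c * g4 / p.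
(* Coefficients of [(1 - s1 t)(1 - g3 t)(1 - s3 t)(1 - s4 t)]. Multiplying by [1 - ta/t] and
   symmetrizing in [t <-> 1/t] yields [B] and [G]. *)
set f1 := - (s1 + g3 + s3 + s4).
set f2 := s1 * g3 + s1 * s3 + s1 * s4 + g3 * s3 + g3 * s4 + s3 * s4.
set f3 := - (s1 * g3 * s3 + s1 * g3 * s4 + s1 * s3 * s4 + g3 * s3 * s4).
set f4 := s1 * g3 * s3 * s4.
exists (- k * (1 - ta * f1 - f4)).
exists (- k * (ta + (f1 - ta * f2) - (f3 - ta * f4))).
move=> t t_0 h1.
have h2 := sqrV_neq1 t t_0 h1.
have h3 : t ^+ 2 - 1 != 0 by rewrite -opprB oppr_eq0.
rewrite !aw_extra_psi_shift ?invr_eq0 // psiV /joukowsky /f1 /f2 /f3 /f4 /s1 /s3 /s4 /ta /k.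
rewrite [p ^+ n.+1]exprS.
by field; rewrite ?pX0 ?t_0 ?h1 ?h2 ?t00 ?p0 ?h3 ?oner_neq0.
Qed.

(** * Polynomial images and their degrees *)

Definition phi (n : nat) : {poly F} := \prod_(k < n) ('X - (joukowsky (t0 * p ^+ k))%:P).

Lemma size_phi n : size (phi n) = n.+1.
Proof. by rewrite size_prod_XsubC /index_enum -enumT size_enum_ord. Qed.

Lemma coef_phi n : (phi n)`_n = 1.
Proof.
have /monicP := monic_prod_XsubC (index_enum 'I_n) predT (fun k : 'I_n => joukowsky (t0 * p ^+ k)).
by rewrite lead_coefE -/(phi n) size_phi.
Qed.

Lemma coef_phi_gt n m : (n < m)%N -> (phi n)`_m = 0.
Proof. by move=> lt_nm; rewrite nth_default ?size_phi. Qed.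

Definition psi_lead (n : nat) : F := \prod_(k < n) - (t0 * p ^+ k).

Lemma psi_leadS n : psi_lead n.+1 = psi_lead n * - (t0 * p ^+ n).
Proof. by rewrite /psi_lead big_ord_recr. Qed.

Lemma psi_lead_neq0 n : psi_lead n != 0.
Proof. by apply/prodf_neq0 => k _; rewrite oppr_eq0 mulf_neq0. Qed.

Lemma psi_phi n t : t != 0 -> psi n t = psi_lead n * (phi n).[joukowsky t].
Proof.
move=> t_0; rewrite /psi /psi_lead /phi horner_prod -big_split /=.
by apply: eq_bigr => k _; rewrite !hornerE /joukowsky; field; rewrite pX0 t_0 t00.
Qed.

Definition ev (w : {poly F}) (t : F) : F := w.[joukowsky t].

Lemma evV w t : ev w t^-1 = ev w t.
Proof. by rewrite /ev /joukowsky invrK addrC. Qed.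

Lemma opAW_ext e f g t : t != 0 -> (forall t, t != 0 -> f t = g t) -> opAW e f t = opAW e g t.
Proof. by move=> t_0 fg; rewrite /opAW !fg ?mulf_neq0 ?invr_eq0. Qed.

Lemma opAW_lin e a f g t :
  opAW e (fun t => a * f t + g t) t = a * opAW e f t + opAW e g t.
Proof. by rewrite /opAW; case: e; ring. Qed.

Lemma opAW0 e t : opAW e (fun=> 0) t = 0.
Proof. by rewrite /opAW; case: e; ring. Qed.

Definition AWlead (e : bool) : F := if e then - (c * g4 / (p * p ^+ N)) else 0.

(* [E] is the image of [w] under the operator, before the subtraction that brings
   the degree back to [N] when [e = true]. *)
Definition AWpoly (e : bool) (w E : {poly F}) : Prop :=
  [/\ (size E <= N.+2)%N, E`_N.+1 = AWlead e * w`_N &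
      forall t, generic t -> E.[joukowsky t] = opAW e (ev w) t].

Lemma AWpoly_lin e a u v E1 E2 :
  AWpoly e u E1 -> AWpoly e v E2 -> AWpoly e (a *: u + v) (a *: E1 + E2).
Proof.
case=> s1 c1 h1 [s2 c2 h2]; split.
- by rewrite (leq_trans (size_polyD _ _)) // geq_max s2 (leq_trans (size_scale_leq _ _)).
- by rewrite !coefD !coefZ c1 c2; ring.
- move=> t gt; rewrite !hornerE h1 // h2 // -opAW_lin.
  by apply: opAW_ext; rewrite ?generic_neq0 // => x _; rewrite /ev !hornerE.
Qed.

Lemma AWpoly_false_true (w E1 E2 : {poly F}) : AWpoly false w E1 ->
  (size E2 <= N.+2)%N -> E2`_N.+1 = AWlead true * w`_N ->
  (forall t, generic t -> E2.[joukowsky t] =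
     aw_extra t * ev w (p * t) + aw_extra t^-1 * ev w (p * t^-1)) ->
  AWpoly true w (E1 + E2).
Proof.
case=> s1 c1 h1 s2 c2 h2; split.
- by rewrite (leq_trans (size_polyD _ _)) // geq_max s2 s1.
- by rewrite coefD c1 c2 /AWlead mul0r add0r.
- by move=> t gt; rewrite hornerD h1 // h2 // /opAW addr0.
Qed.

Lemma AWpoly_false_phi n : (n <= N)%N -> exists E, AWpoly false (phi n) E.
Proof.
case: n => [|n] le_nN.
  exists (aw_eig 0)%:P; split.
  - by rewrite (leq_trans (size_polyC_leq1 _)).
  - by rewrite coefC mul0r.
  - move=> t gt; rewrite hornerC -(opAW_psi0 t); apply: opAW_ext; rewrite ?generic_neq0 // => x _.
    by rewrite /ev /phi /psi !big_ord0 hornerC.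
exists (aw_eig n.+1 *: phi n.+1 + (aw_low n / - (t0 * p ^+ n)) *: phi n); split.
- rewrite (leq_trans (size_polyD _ _)) // geq_max; apply/andP.
  by split; rewrite (leq_trans (size_scale_leq _ _)) // size_phi; lia.
- by rewrite /AWlead mul0r coefD !coefZ !coef_phi_gt ?mulr0 ?addr0 //; lia.
- move=> t gt.
  have -> : opAW false (ev (phi n.+1)) t = (psi_lead n.+1)^-1 * opAW false (psi n.+1) t.
    rewrite -[RHS]addr0 -(opAW0 false t) -opAW_lin; apply: opAW_ext; rewrite ?generic_neq0 // => x x0.
    by rewrite psi_phi // mulrA mulVf ?psi_lead_neq0 // mul1r addr0.
  rewrite opAW_psiS // !psi_phi ?generic_neq0 // !hornerE.
  have h := psi_lead_neq0 n; rewrite psi_leadS.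
  by rewrite /=; field; rewrite h oppr_eq0 mulf_neq0.
Qed.

Lemma AWpoly_true_phi n : (n <= N)%N -> exists E, AWpoly true (phi n) E.
Proof.
move=> le_nN; have [E1 hE1] := AWpoly_false_phi n le_nN.
case: n => [|n] in le_nN hE1 *.
  set k := - (c * g4 / p).
  exists (E1 + (k *: 'X + (k * (g3 / p ^+ N - ((p ^+ N * t0)^-1 + t0 + g3)))%:P)).
  apply: AWpoly_false_true => //.
  - rewrite (leq_trans (size_polyD _ _)) // geq_max.
    by rewrite (leq_trans (size_scale_leq _ _)) ?size_polyX // (leq_trans (size_polyC_leq1 _)).
  - rewrite coefD coefZ coefX coefC /= addr0 /AWlead /phi big_ord0 coefC.
    (* The linear term reaches degree [N + 1] only if [N = 0]. *)
    by case: (N) => [|N'] /=; rewrite ?mulr0 ?expr0 ?mulr1.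
  - move=> t gt; rewrite /ev /phi big_ord0 !hornerE /=
      (aw_extra_psi0 t (generic_neq0 t gt) (generic_sqr t gt)).
    by rewrite /k /=; ring.
have [B [G hBG]] := aw_extra_psiS n.
set k := - (t0 * p ^+ n).
have k0 : k != 0 by rewrite oppr_eq0 mulf_neq0.
exists (E1 + ((c * g4 * t0 / p ^+ 2 / k) *: (phi n * 'X^2) + (B / k) *: (phi n * 'X) + (G / k) *: phi n)).
apply: AWpoly_false_true => //.
- rewrite (leq_trans (size_polyD _ _)) // geq_max (leq_trans (size_polyD _ _)) ?geq_max /=.
    by rewrite (leq_trans (size_scale_leq _ _)) // size_phi; lia.
  apply/andP; split; rewrite (leq_trans (size_scale_leq _ _)) //.
    by rewrite size_mulXn -?size_poly_eq0 size_phi //; lia.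
  by rewrite size_mulX -?size_poly_eq0 size_phi //; lia.
(* Only the [X^2] term can reach degree [N + 1], and it does so exactly when [n + 1 = N]. *)
- have eX2 : (phi n * 'X^2)`_N.+1 = (phi n.+1)`_N.
    rewrite coefMXn (_ : (N.+1 < 2)%N = false) ?subSS ?subn1; last by lia.
    move: le_nN; rewrite leq_eqVlt => /orP[/eqP <-|lt_nN]; first by rewrite !coef_phi.
    by rewrite !coef_phi_gt //; lia.
  rewrite !coefD !coefZ eX2 coefMX /= ![(phi n)`__]coef_phi_gt ?mulr0 ?addr0 //; last exact: ltnW.
  move: le_nN; rewrite leq_eqVlt => /orP[/eqP <-|lt_nN].
    rewrite /AWlead coef_phi /k [p ^+ n.+1]exprS.
    by field; rewrite ?oppr_eq0 ?mulf_neq0 ?pX0 ?p0 ?t00.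
  by rewrite coef_phi_gt ?mulr0.
- move=> t gt; have [t_0 t1] := (generic_neq0 t gt, generic_sqr t gt).
  have e1 x : x != 0 -> ev (phi n.+1) x = psi n.+1 x / psi_lead n.+1.
    by move=> x0; rewrite psi_phi // mulrC mulKf ?psi_lead_neq0.
  rewrite !e1 ?mulf_neq0 ?invr_eq0 // !mulrA -mulrDl hBG // psi_phi // !hornerE.
  have h := psi_lead_neq0 n; rewrite psi_leadS -/k.
  by rewrite /=; field; rewrite h k0 p0.
Qed.

(** Induction on the size, removing the top term with the monic [phi n]. *)
Lemma AWpoly_ex e (w : {poly F}) : (size w <= N.+1)%N -> exists E, AWpoly e w E.
Proof.
suff H n : (n <= N.+1)%N -> forall w : {poly F}, (size w <= n)%N -> exists E, AWpoly e w E.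
  exact: H.
elim: n => [|n IH] le_nN {}w.
  rewrite leqn0 size_poly_eq0 => /eqP ->; exists 0; split.
  - by rewrite size_poly0.
  - by rewrite !coef0 mulr0.
  - move=> t gt; rewrite horner0 -(opAW0 e t).
    by apply: opAW_ext; rewrite ?generic_neq0 // => x _; rewrite /ev horner0.
move=> sw; have [E1 hE1] : exists E, AWpoly e (phi n) E.
  by case: e {IH}; [apply: AWpoly_true_phi|apply: AWpoly_false_phi].
have [E2 hE2] : exists E, AWpoly e (w - w`_n *: phi n) E.
  apply: IH => //; first exact: ltnW.
  apply/leq_sizeP => m; rewrite leq_eqVlt coefB coefZ => /orP[/eqP <-|lt_nm].
    by rewrite coef_phi mulr1 subrr.
  by rewrite coef_phi_gt // mulr0 subr0 nth_default // (leq_trans sw).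
exists (w`_n *: E1 + E2); rewrite -{1}[w](subrK (w`_n *: phi n)) addrC.
exact: AWpoly_lin.
Qed.

(** A multiple of [phi N.+1], monic of degree [N + 1], removes the top coefficient and leaves the
    values on the grid unchanged. *)
Lemma AWpoly_reduced e (w : {poly F}) : (size w <= N.+1)%N ->
  exists D : {poly F}, (size D <= N.+1)%N /\
    forall t, generic t ->
      D.[joukowsky t] = opAW e (ev w) t - AWlead e * w`_N * (phi N.+1).[joukowsky t].
Proof.
move=> sw; have [E [sE cE hE]] := AWpoly_ex e w sw.
exists (E - E`_N.+1 *: phi N.+1); split; last first.
  by move=> t gt; rewrite !hornerE hE // cE.
apply/leq_sizeP => m; rewrite leq_eqVlt coefB coefZ => /orP[/eqP <-|lt_nm].
  by rewrite coef_phi mulr1 subrr.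
by rewrite coef_phi_gt // mulr0 subr0 nth_default // (leq_trans sE).
Qed.

Lemma opAW_sum e K (f : nat -> F -> F) t :
  opAW e (fun x => \sum_(n < K) f n x) t = \sum_(n < K) opAW e (f n) t.
Proof.
elim: K => [|K IH].
  by rewrite big_ord0 -[RHS](opAW0 e t) /opAW; case: e; rewrite !big_ord0.
by rewrite [RHS]big_ord_recr -IH /opAW; case: e {IH}; rewrite !big_ord_recr /=; ring.
Qed.

(** * Eigenfunctions, and the tridiagonal action on the grid *)

Section Eigen.
Variables (th : F) (phi43_coef : nat -> F).
Hypothesis phi43_coef_rec : forall n, (n < N)%N -> phi43_coef n.+1 * aw_low n =
  phi43_coef n * (th - aw_eig n).
Hypothesis phi43_coef_last : phi43_coef N * (th - aw_eig N) = 0.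

Definition eigenf (t : F) : F := \sum_(n < N.+1) phi43_coef n * psi n t.

(** By bidiagonality the coefficient of [psi n] receives contributions from [n] and [n + 1] only,
    which is [phi43_coef_rec]; at [n = N] there is no successor and [phi43_coef_last] applies. *)
Lemma opAW_eigenf t : generic t -> opAW false eigenf t = th * eigenf t.
Proof.
move=> gt; rewrite [LHS](opAW_sum false N.+1 (fun n x => phi43_coef n * psi n x)) big_ord_recl /=.
have opZ a f : opAW false (fun x => a * f x) t = a * opAW false f t.
  by rewrite /opAW; ring.
under eq_bigr => n _ do rewrite opZ opAW_psiS // mulrDr
  [phi43_coef _ * (aw_low _ * _)]mulrA phi43_coef_rec //.
rewrite opZ opAW_psi0 big_split /= addrA.
rewrite /eigenf mulr_sumr [X in _ = X]big_ord_recr [in X in X + _]/=.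
have -> : phi43_coef 0 * aw_eig 0 + \sum_(i < N) phi43_coef (lift ord0 i) * (aw_eig i.+1 * psi i.+1 t) =
  \sum_(i < N.+1) phi43_coef i * (aw_eig i * psi i t).
  by rewrite big_ord_recl /= /psi big_ord0 mulr1.
rewrite big_ord_recr /= addrAC -big_split /=; congr (_ + _).
  by apply: eq_bigr => i _; ring.
by move/eqP: phi43_coef_last; rewrite mulrBr subr_eq0 mulrCA mulrA [in RHS]mulrA
  [th * _]mulrC => /eqP ->; ring.
Qed.

Definition gridpt (m : nat) : F := t0 * p ^+ m.

Hypothesis grid_generic : forall i, (i <= N.*2)%N -> 1 - t0 ^+ 2 * p ^+ i != 0.

Lemma gridpt_neq0 m : gridpt m != 0. Proof. exact: mulf_neq0. Qed.

Lemma gridptS m : p * gridpt m = gridpt m.+1.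
Proof. by rewrite /gridpt exprS mulrCA. Qed.

Lemma gridptVS m : p * (gridpt m.+1)^-1 = (gridpt m)^-1.
Proof. by rewrite -gridptS invfM mulVKf. Qed.

Lemma den_gridpt m : (m <= N)%N -> 1 - gridpt m ^+ 2 != 0.
Proof. by move=> le_mN; rewrite /gridpt exprMn -exprM grid_generic //; lia. Qed.

Lemma den_gridptS m : (m < N)%N -> 1 - p * gridpt m ^+ 2 != 0.
Proof.
move=> lt_mN; rewrite /gridpt exprMn -exprM mulrCA -exprS grid_generic //; lia.
Qed.

Lemma den_gridptV m : (m < N)%N -> 1 - p * (gridpt m.+1)^-1 ^+ 2 != 0.
Proof.
move=> lt_mN; have h := den_gridptS m lt_mN.
rewrite (_ : _ - _ = - (1 - p * gridpt m ^+ 2) / (p * gridpt m ^+ 2)).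
  by rewrite mulf_neq0 ?oppr_eq0 // invr_eq0 mulf_neq0 ?expf_neq0 ?gridpt_neq0.
by rewrite -gridptS; field; rewrite gridpt_neq0 p0.
Qed.

Lemma generic_gridpt m : (m <= N)%N -> generic (gridpt m).
Proof.
move=> le_mN; rewrite /generic gridpt_neq0 den_gridpt //=; apply/andP; split.
  move: le_mN; rewrite leq_eqVlt => /orP[/eqP ->|lt_mN]; last by rewrite den_gridptS.
  by apply/orP; right; rewrite /gridpt mulrC.
by case: m le_mN => [|m] lt_mN; rewrite ?den_gridptV // /gridpt expr0 mulr1 eqxx orbT.
Qed.

(** Summation by parts: [tri_up N = 0] discards [f N.+1], and [tri_down 0 = 0] discards the default
    [f 0.-1 = f 0]. *)
Lemma sum_tridiag (tri_up tri_down tri_diag covec f : nat -> F) : tri_down 0 = 0 -> tri_up N = 0 ->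
    (forall m, (m <= N)%N ->
       (if (m < N)%N then covec m.+1 * tri_down m.+1 else 0) + covec m * tri_diag m +
       (if m is k.+1 then covec k * tri_up k else 0) = th * covec m) ->
  \sum_(m < N.+1) covec m * (tri_up m * f m.+1 + tri_down m * f m.-1 + tri_diag m * f m) =
  th * \sum_(m < N.+1) covec m * f m.
Proof.
move=> tri_down0 upN rec; rewrite mulr_sumr.
have -> : \sum_(m < N.+1) th * (covec m * f m) =
  \sum_(m < N.+1) ((if (m < N)%N then covec m.+1 * tri_down m.+1 * f m else 0) + covec m * tri_diag m * f m +
     (if val m is k.+1 then covec k * tri_up k * f m else 0)).
  apply: eq_bigr => -[m lt_m] _ /=; rewrite mulrA -(rec m lt_m).
  by case: ifP => _; case: m {lt_m} => [|k] /=; ring.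
rewrite !big_split /=.
under eq_bigr => m _ do rewrite !mulrDr.
rewrite !big_split /=.
have -> : \sum_(m < N.+1) (if (m < N)%N then covec m.+1 * tri_down m.+1 * f m else 0) =
          \sum_(m < N.+1) covec m * (tri_down m * f m.-1).
  rewrite big_ord_recr [RHS]big_ord_recl /= ltnn tri_down0 mul0r mulr0 addr0 add0r.
  by apply: eq_bigr => m _; rewrite ltn_ord mulrA.
have -> : \sum_(m < N.+1) (if val m is k.+1 then covec k * tri_up k * f m else 0) =
          \sum_(m < N.+1) covec m * (tri_up m * f m.+1).
  rewrite big_ord_recl [RHS]big_ord_recr /= upN mul0r mulr0 addr0 add0r.
  by apply: eq_bigr => m _; rewrite mulrA.
rewrite [RHS]addrC addrA; congr (_ + _); by apply: eq_bigr => m _; rewrite mulrA.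
Qed.

Definition tri_up (e : bool) m : F := aw_coef (gridpt m) + (if e then aw_extra (gridpt m) else 0).
Definition tri_down (e : bool) m : F := aw_coef (gridpt m)^-1 + (if e then aw_extra (gridpt m)^-1 else 0).
Definition tri_diag m : F := aw_eig 0 - aw_coef (gridpt m) - aw_coef (gridpt m)^-1.

Lemma tri_up_last e : tri_up e N = 0.
Proof.
have h : 1 - gridpt N / (p ^+ N * t0) = 0 by rewrite /gridpt [t0 * _]mulrC divff ?subrr ?mulf_neq0.
by rewrite /tri_up /aw_coef /aw_extra h; case: e; rewrite !(mulr0, mul0r) addr0.
Qed.

Lemma tri_down0 e : tri_down e 0 = 0.
Proof.
have h : 1 - (gridpt 0)^-1 * t0 = 0 by rewrite /gridpt expr0 mulr1 mulVf ?subrr.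
by rewrite /tri_down /aw_coef /aw_extra h; case: e; rewrite !(mulr0, mul0r) addr0.
Qed.

(** [p / t_m] is the inverse of [t_(m-1)], and [f] does not see the inversion; at [m = 0] the
    coefficient is zero. *)
Lemma opAW_gridpt e f m : (forall t, f t^-1 = f t) ->
  opAW e f (gridpt m) = tri_up e m * f (gridpt m.+1) +
    tri_down e m * f (gridpt m.-1) + tri_diag m * f (gridpt m).
Proof.
move=> fV; have -> : tri_down e m * f (gridpt m.-1) = tri_down e m * f (p * (gridpt m)^-1).
  by case: m => [|m]; rewrite ?tri_down0 ?mul0r // gridptVS fV.
by rewrite /opAW /tri_up /tri_down /tri_diag gridptS; case: e; ring.
Qed.

Lemma aw_coef_extra t : t != 0 -> 1 - t ^+ 2 != 0 -> 1 - p * t ^+ 2 != 0 ->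
  (aw_coef t + aw_extra t) * (1 - t * g4) = aw_coef t * (1 - g4 / (p * t)).
Proof.
move=> t_0 h1 h2; rewrite /aw_coef /aw_extra.
by field; rewrite ?pX0 ?t_0 ?h1 ?h2 ?t00 ?p0.
Qed.

(** * The symmetrizing weight and the conjugation by [H] *)

Section Weights.
Variables (kt h H : nat -> F).
Hypothesis ktilde_rec : forall m, (m < N)%N -> kt m.+1 * aw_coef (gridpt m.+1)^-1 = kt m * aw_coef (gridpt m).
Hypothesis h_num : forall m, (m < N)%N -> 1 - gridpt m * g4 != 0.
Hypothesis h_den : forall m, (m < N)%N -> 1 - g4 / gridpt m.+1 != 0.
Hypothesis hE : forall m, (m < N)%N -> h m = (1 - gridpt m * g4) / (1 - g4 / gridpt m.+1).
Hypothesis HS : forall m, H m.+1 = H m * h m.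

Definition covec (e : bool) (m : nat) : F := kt m * eigenf (gridpt m) / (if e then H m else 1).

(** Together with [tri_down_true]: the matrix for [e = true] is [H T H^-1], with [T] the one for
    [e = false] and the same diagonal. Left eigenvectors are therefore divided by [H]. *)
Lemma tri_up_true m : (m < N)%N -> tri_up true m * h m = tri_up false m.
Proof.
move=> lt_mN; rewrite /tri_up addr0 hE // mulrA.
by rewrite aw_coef_extra ?gridpt_neq0 ?den_gridpt ?den_gridptS ?(ltnW lt_mN) // gridptS mulfK ?h_den.
Qed.

Lemma tri_down_true m : (m < N)%N -> tri_down true m.+1 = tri_down false m.+1 * h m.
Proof.
move=> lt_mN; rewrite /tri_down addr0 hE //.
have e : (aw_coef (gridpt m.+1)^-1 + aw_extra (gridpt m.+1)^-1) * (1 - g4 / gridpt m.+1) =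
         aw_coef (gridpt m.+1)^-1 * (1 - gridpt m * g4).
  rewrite [g4 / _]mulrC aw_coef_extra ?invr_eq0 ?gridpt_neq0 ?den_gridptV //.
    by rewrite gridptVS invrK [g4 * _]mulrC.
  by apply: sqrV_neq1; rewrite ?gridpt_neq0 ?den_gridpt.
by rewrite mulrA -e mulfK ?h_den.
Qed.

(** The detailed balance [ktilde_rec] turns column [m] of the transposed problem into row [m] of the
    operator applied to [eigenf], where the eigenvalue equation holds. *)
Lemma covec_rec e m : (m <= N)%N ->
  (if (m < N)%N then covec e m.+1 * tri_down e m.+1 else 0) + covec e m * tri_diag m +
  (if m is k.+1 then covec e k * tri_up e k else 0) = th * covec e m.
Proof.
move=> le_mN.
have -> : (if (m < N)%N then covec e m.+1 * tri_down e m.+1 else 0) =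
  (if e then H m else 1)^-1 * kt m * (tri_up false m * eigenf (gridpt m.+1)).
  case: ltnP => [lt_mN|le_Nm]; last first.
    by rewrite (_ : m = N) ?tri_up_last ?mul0r ?mulr0 //; apply/eqP; rewrite eqn_leq le_mN.
  rewrite /covec; have ktm := ktilde_rec m lt_mN.
  have h0 : h m != 0 by rewrite hE // mulf_neq0 ?invr_eq0 ?h_num ?h_den.
  rewrite /tri_up addr0; case: e.
    rewrite tri_down_true // HS invfM /tri_down addr0 mulrACA [kt m.+1 * _]mulrC.
    transitivity (eigenf (gridpt m.+1) * (H m)^-1 * (kt m.+1 * aw_coef (gridpt m.+1)^-1) * ((h m)^-1 * h m)).
      by ring.
    by rewrite ktm mulVf // ; ring.
  by rewrite /tri_down addr0 invr1 !mulr1 mul1r mulrAC ktm; ring.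
have -> : (if m is k.+1 then covec e k * tri_up e k else 0) =
  (if e then H m else 1)^-1 * kt m * (tri_down false m * eigenf (gridpt m.-1)).
  case: m le_mN => [|m] lt_mN; first by rewrite tri_down0 mul0r mulr0.
  rewrite /covec; have ktm := ktilde_rec m lt_mN.
  have h0 : h m != 0 by rewrite hE // mulf_neq0 ?invr_eq0 ?h_num ?h_den.
  rewrite /= /tri_down addr0; case: e.
    rewrite HS invfM.
    have -> : tri_up true m = tri_up false m / h m by rewrite -tri_up_true // mulfK.
    transitivity ((H m)^-1 * (h m)^-1 * eigenf (gridpt m) * (kt m.+1 * aw_coef (gridpt m.+1)^-1)); last by ring.
    by rewrite ktm /tri_up addr0; ring.
  by rewrite /tri_up addr0 invr1 !mulr1 mul1r mulrAC -ktm; ring.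
have eig := opAW_eigenf (gridpt m) (generic_gridpt m le_mN).
rewrite opAW_gridpt in eig; last by move=> t; apply: eq_bigr => n _; rewrite psiV.
rewrite /covec mulrA [th * _]mulrCA -eig; ring.
Qed.

Lemma covec_opAW e f : (forall t, f t^-1 = f t) ->
  \sum_(m < N.+1) covec e m * opAW e f (gridpt m) = th * \sum_(m < N.+1) covec e m * f (gridpt m).
Proof.
move=> fV.
under eq_bigr => m _ do rewrite opAW_gridpt //.
apply: (sum_tridiag _ _ _ _ (fun m => f (gridpt m))); [exact: tri_down0|exact: tri_up_last|].
by move=> m; apply: covec_rec.
Qed.

(** [D] differs from the image of [w] by a multiple of [phi N.+1], which is zero at every grid
    point, so the left eigenvector acts on both alike. *)
Lemma AW_functional e (w : {poly F}) : (size w <= N.+1)%N ->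
  exists D : {poly F}, [/\ (size D <= N.+1)%N,
    forall t, generic t ->
      D.[joukowsky t] = opAW e (ev w) t - AWlead e * w`_N * (phi N.+1).[joukowsky t] &
    \sum_(m < N.+1) covec e m * D.[joukowsky (gridpt m)] =
    th * \sum_(m < N.+1) covec e m * w.[joukowsky (gridpt m)]].
Proof.
move=> sw; have [D [sD hD]] := AWpoly_reduced e w sw.
exists D; split => //; rewrite -(covec_opAW e (ev w)); last exact: evV.
apply: eq_bigr => m _; rewrite hD ?generic_gridpt ?leq_ord //.
rewrite /phi horner_prod (bigD1 m) //= -/(gridpt m) hornerXsubC subrr mul0r mulr0 subr0 //.
Qed.

End Weights.
End Eigen.
End AskeyWilson.

(** * Lagrange interpolation *)

Section Interpolation.
Context {F : fieldType} {n : nat} (z : 'I_n -> F).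

Definition nodal (k : 'I_n) : {poly F} := \prod_(i | i != k) ('X - (z i)%:P).

Lemma size_nodal k : size (nodal k) = n.
Proof.
rewrite size_prod => [|i _]; last by rewrite polyXsubC_eq0.
under eq_bigr => i _ do rewrite size_XsubC.
rewrite sum_nat_const (eq_card (B := predC1 k)) ?cardC1 ?card_ord //.
by have := ltn_ord k; lia.
Qed.

Lemma nodal_lead k : (nodal k)`_n.-1 = 1.
Proof.
have /monicP := monic_prod_XsubC (index_enum 'I_n) (fun i => i != k) z.
by rewrite lead_coefE -/(nodal k) size_nodal.
Qed.

Lemma nodal_root k i : i != k -> (nodal k).[z i] = 0.
Proof.
by move=> ik; rewrite horner_prod (bigD1 i) //= hornerXsubC subrr mul0r.
Qed.

(** The difference of both sides has size at most [n] and the [n] distinct roots [z k]. *)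
Lemma lagrange_interpolation (D : {poly F}) (x : F) :
  injective z -> (size D <= n)%N ->
  \sum_k D.[z k] / (nodal k).[z k] * (nodal k).[x] = D.[x].
Proof.
move=> z_inj sD.
pose E := \sum_k (D.[z k] / (nodal k).[z k]) *: nodal k - D.
suff E0 : E = 0.
  have /eqP := congr1 (fun r : {poly F} => r.[x]) E0.
  rewrite /E hornerD hornerN horner_sum horner0 subr_eq0 => /eqP <-.
  by apply: eq_bigr => k _; rewrite hornerZ.
apply: (@roots_geq_poly_eq0 _ _ [seq z k | k <- enum 'I_n]).
- apply/allP => _ /mapP[k _ ->]; rewrite rootE /E hornerD hornerN horner_sum.
  rewrite (bigD1 k) //= big1 => [|i ik]; last first.
    by rewrite hornerZ [X in _ * X]nodal_root ?mulr0 1?eq_sym.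
  rewrite addr0 hornerZ divfK ?subrr // /nodal horner_prod.
  apply/prodf_neq0 => i ik; rewrite hornerXsubC subr_eq0.
  by apply: contra ik => /eqP/z_inj ->.
- by rewrite map_inj_uniq ?enum_uniq.
- rewrite size_map size_enum_ord (leq_trans (size_polyD _ _)) // geq_max size_polyN sD andbT.
  apply: (leq_trans (size_sum _ _ _)); apply/bigmax_leqP => k _.
  by rewrite (leq_trans (size_scale_leq _ _)) // size_nodal.
Qed.

End Interpolation.

(** * Identification of the parameters *)

Section Matching.
Context {C : fieldType}.
Variable P : params C.
Local Notation q := (q P).
Local Notation N := (two_s P).
Local Notation Ni := (Posz (two_s P)).
Local Notation b := (bl P LDot).
Local Notation c := (cl P LDot).
Local Notation bs := (bl P LStar).
Local Notation cs := (cl P LStar).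
Hypotheses (q_neq0 : q != 0) (r0_neq0 : r0 P != 0)
  (bl_neq0 : forall a, bl P a != 0) (cl_neq0 : forall a, cl P a != 0)
  (bl_cl : forall a, bl P a * cl P a = (r0 P) ^- 2)
  (zeta_neq0 : zeta P != 0)
  (zetaE : (zeta P) ^- 2 = bl P LDia * r0 P * q ^+ N).

(* In terms of [t = q u^2], the zeros of [Lambda2] with [u^4 <> 1] are [p^N t0], [1 / t0],
   [1 / g3] and [1 / g4] for [epsilon = -]. *)
Definition qsq : C := q ^+ 2.
Definition grid0 : C := bl P LDia * r0 P.
Definition aw_g3 : C := - (b / cs) * q * qsq ^+ N.
Definition aw_g4 : C := - (cs / c) * q.

Local Notation d := (aw_coef qsq c grid0 aw_g3 aw_g4 N).
Local Notation ae := (aw_extra qsq c grid0 aw_g3 aw_g4 N).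
Local Notation th := (aw_eig qsq c aw_g3 aw_g4 N).

Let Q := q ^+ N.
Let Q_neq0 : Q != 0. Proof. exact: expf_neq0. Qed.

Lemma qsqN : qsq ^+ N = Q ^+ 2.
Proof. by rewrite /qsq /Q exprAC. Qed.

Lemma q_powS : q ^ (Ni + 1) = Q * q.
Proof. by rewrite expfzDr // expr1z -exprnP. Qed.

Lemma q_powP : q ^ (Ni - 1) = Q / q.
Proof. by rewrite expfzDr // exprN1 -exprnP. Qed.

Lemma grid0E : grid0 = (zeta P ^+ 2 * Q)^-1.
Proof. by rewrite invfM zetaE /Q mulfK // -/Q. Qed.

Lemma bsE : bs = b * c / cs.
Proof. by rewrite bl_cl -(bl_cl LStar) mulfK. Qed.

(** With [t = q u^2], this and the next two lemmas turn the paired factors of [g] and [Y] into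
    [X(t)], [X(p/t)], [X(p t)] minus the node [X(q v^2)]. *)
Lemma bb_shift0 u v : u != 0 -> v != 0 ->
  bb (u / v) * bb (q * u * v) = joukowsky (q * u ^+ 2) - joukowsky (q * v ^+ 2).
Proof. by move=> u0 v0; rewrite /bb /joukowsky; field; rewrite u0 v0 q_neq0. Qed.

Lemma bb_shiftm u v : u != 0 -> v != 0 ->
  bb (u / (q * v)) * bb (u * v) = joukowsky (qsq * (q * u ^+ 2)^-1) - joukowsky (q * v ^+ 2).
Proof. by move=> u0 v0; rewrite /bb /joukowsky /qsq; field; rewrite u0 v0 q_neq0. Qed.

Lemma bb_shiftp u v : u != 0 -> v != 0 ->
  bb (q * u / v) * bb (q ^+ 2 * u * v) = joukowsky (qsq * (q * u ^+ 2)) - joukowsky (q * v ^+ 2).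
Proof. by move=> u0 v0; rewrite /bb /joukowsky /qsq; field; rewrite u0 v0 q_neq0. Qed.

(** * The ingredients of [L] at a point [u] *)

Section AtU.
Variable u : C.
Hypotheses (u0 : u != 0) (u4 : (u ^+ 2) ^+ 2 - 1 != 0) (qu4 : (q * u ^+ 2) ^+ 2 - 1 != 0)
  (q2u4 : (q ^+ 2 * u ^+ 2) ^+ 2 - 1 != 0).

Let qu4' : 1 - (q * u ^+ 2) ^+ 2 != 0. Proof. by rewrite -opprB oppr_eq0. Qed.
Let q2u4' : 1 - q ^+ 2 * (q * u ^+ 2) ^+ 2 != 0.
Proof.
apply: contra q2u4 => /eqP h; apply/eqP.
by transitivity (- (1 - q ^+ 2 * (q * u ^+ 2) ^+ 2)); [ring|rewrite h oppr0].
Qed.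
Let qu4'' : q * u ^+ 2 * (q * u ^+ 2) - 1 != 0. Proof. exact: qu4. Qed.
Let q2u4'' : 1 - q ^+ 2 * (q ^+ 2 * u ^+ 4) != 0.
Proof. by rewrite (_ : q ^+ 2 * u ^+ 4 = (q * u ^+ 2) ^+ 2) //; ring. Qed.
Let q2u4''' : (q * u * (q * u)) ^+ 2 - 1 != 0.
Proof. by rewrite (_ : q * u * (q * u) = q ^+ 2 * u ^+ 2) //; ring. Qed.

Lemma Lambda1E e :
  u ^ (2 * sgn e + 1) * Lambda1 P e u / (bb (u ^+ 2) * bb (q * u ^+ 2)) =
  d (q * u ^+ 2)^-1 + (if e then ae (q * u ^+ 2)^-1 else 0).
Proof.
(* This confines the dependence on the sign to one power of [u] and the last factor of [Lambda1]. *)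
have e3 : u ^ (2 * sgn e + 1) / u ^ sgn e = if e then u ^+ 2 else 1.
  case: e; first by change (u ^+ 3 / u = u ^+ 2); field.
  by rewrite (_ : 2 * sgn false + 1 = -1) // divff // expfz_neq0.
rewrite /Lambda1.
set l1 := (q ^ (Ni + 1) * u * _ - _); set l2 := (q ^ (Ni + 1) * u * _ - _).
set l3 := (u * cs * _ + _).
transitivity ((u ^ (2 * sgn e + 1) / u ^ sgn e) * (q ^ (- (Ni + 1)) * l1 * l2 * l3 *
  (u * (if e then 1 else c / cs) + u^-1 * (if e then bs / b else 1)) / (bb (u ^+ 2) * bb (q * u ^+ 2)))).
  by ring.
rewrite e3 {}/l1 {}/l2 {}/l3 -!invr_expz -exprnP -/Q q_powS
  /aw_coef /aw_extra qsqN /aw_g3 /aw_g4 qsqN grid0E bsE /qsq /bb.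
by case: e {e3}; field; rewrite u0 q_neq0 u4 qu4 !cl_neq0 Q_neq0 zeta_neq0 ?bl_neq0.
Qed.

Lemma Lambda2E e :
  q ^ (- sgn e - 1) * u^-1 * Lambda2 P e u / (bb (u ^+ 2) * bb (q ^+ 2 * u ^+ 2)) =
  d (q * u ^+ 2) + (if e then ae (q * u ^+ 2) else 0).
Proof.
have e3 : q ^ (- sgn e - 1) / u ^ sgn e = if e then (q ^+ 2 * u)^-1 else u.
  case: e; first by change (q ^- 2 / u = (q ^+ 2 * u)^-1); field; rewrite u0 q_neq0.
  by change (1 / u^-1 = u); rewrite div1r invrK.
rewrite /Lambda2.
set l1 := (q ^ (Ni - 1) * _ * _ - _); set l2 := (q ^ (Ni - 1) * _ * _ - _).
set l3 := (_ + u^-1 * cs * _).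
transitivity ((q ^ (- sgn e - 1) / u ^ sgn e) * (u^-1 * (u ^+ 2 - u ^- 2) * q ^ (- (Ni + 1)) *
  l1 * l2 * l3 *
  (q ^+ 2 * u * (if e then bs / b else 1) + u^-1 * (if e then 1 else c / cs)) /
  ((q * u ^+ 2 - q^-1 * u ^- 2) * (bb (u ^+ 2) * bb (q ^+ 2 * u ^+ 2))))).
  by rewrite !invfM; ring.
rewrite e3 {}/l1 {}/l2 {}/l3 -!invr_expz -exprnP -/Q q_powS q_powP
  /aw_coef /aw_extra qsqN /aw_g3 /aw_g4 qsqN grid0E bsE /qsq /bb.
by case: e {e3}; field; rewrite ?u0 ?q_neq0 ?u4 ?qu4' ?q2u4''
  ?q2u4''' ?cl_neq0 ?Q_neq0 ?zeta_neq0 ?bl_neq0 ?qu4''.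
Qed.

Hypotheses (q2_neq : q ^+ 2 + 1 != 0) (q4_neq : (q ^+ 2) ^+ 2 - 1 != 0).

Lemma clE a : cl P a = (r0 P ^+ 2 * bl P a)^-1.
Proof. by rewrite invfM -(bl_cl a) mulrC mulKf. Qed.

(** Once [cl a] is replaced by [(r0^2 bl a)^-1], this is an identity of rational functions in [u],
    [q], [q^N], [r0] and the three [bl a]. *)
Lemma diagE :
  (q + q^-1) ^+ 2 / (rho P * bb (u ^+ 2) * bb (q ^+ 2 * u ^+ 2)) * (etas P + Defs.eta P * UU P u) =
  th 0 - d (q * u ^+ 2) - d (q * u ^+ 2)^-1.
Proof.
rewrite /rho /etas /Defs.eta /UU /omega /theta_s /thetak -!invr_expz q_powS -!exprnP -/Q /aw_eig /aw_b /aw_coef qsqN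
  /aw_g3 /aw_g4 qsqN /grid0 /qsq /bb expr0 divr1 mulr1 !clE.
move: (bl_neq0 LDot) (bl_neq0 LStar) (bl_neq0 LDia).
move: (bl P LDot) (bl P LStar) (bl P LDia) => x y z x0 y0 z0.
field; rewrite u0 q_neq0 u4 qu4 x0 r0_neq0 oner_neq0 y0 z0 Q_neq0 q2u4'' qu4' q2u4''' q2_neq.
by rewrite oppr_eq0 expf_neq0.
Qed.

Lemma qh_neq0 : qh P != 0.
Proof. by apply: contraNneq q_neq0 => h; rewrite /Defs.q h expr0n. Qed.

Lemma qh_pow (j : nat) : qh P ^ (1 + 2 * j%:Z - Ni) = qh P * q ^+ j / qh P ^+ N.
Proof.
rewrite !expfzDr ?qh_neq0 // expr1z -exprnN exprnP; congr (_ * _ / _).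
by rewrite -PoszM -exprnP exprM.
Qed.

Lemma gridE :
  \prod_(j < N.+1) (bb (qh P ^ (1 + 2 * j%:Z - Ni) * u * zeta P) *
                    bb (qh P ^ (1 + 2 * j%:Z - Ni) * u * (zeta P)^-1)) =
  (phi qsq grid0 N.+1).[joukowsky (q * u ^+ 2)].
Proof.
(* Reversing the index of the [1/zeta] factors pairs the arguments [u/v] and [q u v], with
   [q v^2 = t0 p^(N-j)], so that [bb_shift0] applies. *)
rewrite big_split [X in _ * X = _](reindex_inj rev_ord_inj) -big_split /=.
rewrite /phi horner_prod [RHS](reindex_inj rev_ord_inj) /=.
apply: eq_bigr => j _; rewrite hornerXsubC !qh_pow subSS.
have le_jN : (j <= N)%N := leq_ord j.
have qhN : qh P ^+ N != 0 by rewrite expf_neq0 ?qh_neq0.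
have QE : Q = qh P ^+ N ^+ 2 by rewrite /Q exprAC.
have qj : q ^+ j != 0 by rewrite expf_neq0.
have qNj : q ^+ (N - j) = Q / q ^+ j by rewrite expfB_cond // (negbTE q_neq0) /= add0n.
pose v := (qh P * q ^+ j / qh P ^+ N * zeta P)^-1.
have v0 : v != 0 by rewrite invr_eq0 !mulf_neq0 ?invr_eq0 ?qh_neq0.
rewrite (_ : _ * u * zeta P = u / v); last by rewrite /v invrK; ring.
have qE : q = qh P ^+ 2 by [].
rewrite qNj (_ : _ / qh P ^+ N * u / zeta P = q * u * v); last first.
  by rewrite /v QE qE; field; rewrite zeta_neq0 qhN -?qE qj qh_neq0.
rewrite bb_shift0 //; congr (_ - joukowsky _).
rewrite grid0E /qsq exprAC qNj /v QE qE; field.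
by rewrite zeta_neq0 qhN -?qE qj qh_neq0.
Qed.

(** Hence the product subtracted in [Y] is exactly the one that removes the term of degree
    [N + 1]. *)
Lemma AWlead_trueE : q ^ (- 1 - 2 * Ni) * cs = AWlead qsq c aw_g4 N true.
Proof.
have -> : q ^ (- 1 - 2 * Ni) = q^-1 * (Q ^+ 2)^-1.
  rewrite expfzDr // exprN1; congr (_ * _).
  by rewrite -invr_expz -PoszM -exprnP mulnC exprM.
rewrite /AWlead qsqN /aw_g4 /qsq; field.
by rewrite ?q_neq0 ?Q_neq0 ?cl_neq0.
Qed.

End AtU.

Lemma prod_Ybar (y : 'I_N.+1 -> C) (k : 'I_N.+1) (f : C -> C) :
  \prod_(v <- Ybar P y k) f v = \prod_(i | i != k) f (y i).
Proof. by rewrite /Ybar big_map big_filter big_enum_cond. Qed.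

Definition node (y : 'I_N.+1 -> C) (i : 'I_N.+1) : C := joukowsky (q * y i ^+ 2).

(** [Y] is the reduced operator on [w_j] without its multiplication part, which [L] adds back on the
    diagonal. *)
Lemma YYE e (y : 'I_N.+1 -> C) (j : 'I_N.+1) u : (forall i, y i != 0) ->
  u != 0 -> (u ^+ 2) ^+ 2 - 1 != 0 -> (q * u ^+ 2) ^+ 2 - 1 != 0 ->
  (q ^+ 2 * u ^+ 2) ^+ 2 - 1 != 0 -> q ^+ 2 + 1 != 0 -> (q ^+ 2) ^+ 2 - 1 != 0 ->
  let t := q * u ^+ 2 in let w := nodal (node y) j in
  YY P e u (Ybar P y j) =
  opAW qsq c grid0 aw_g3 aw_g4 N e (ev w) t - AWlead qsq c aw_g4 N e * (phi qsq grid0 N.+1).[joukowsky t] -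
  (th 0 - d t - d t^-1) * w.[joukowsky t].
Proof.
move=> y0 u0 u4 qu4 q2u4 q2 q4 t w.
rewrite /YY !prod_Ybar Lambda1E // Lambda2E // -/t.
have wE x : w.[x] = \prod_(i | i != j) (x - node y i).
  by rewrite /w /nodal horner_prod; apply: eq_bigr => i _; rewrite hornerXsubC.
have -> : \prod_(i | i != j) (bb (u / (q * y i)) * bb (u * y i)) = w.[joukowsky (qsq * t^-1)].
  by rewrite wE; apply: eq_bigr => i _; rewrite bb_shiftm.
have -> : \prod_(i | i != j) (bb (q * u / y i) * bb (q ^+ 2 * u * y i)) = w.[joukowsky (qsq * t)].
  by rewrite wE; apply: eq_bigr => i _; rewrite bb_shiftp.
rewrite gridE // -/t /opAW /ev; case: e; first by rewrite -AWlead_trueE //; ring.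
by rewrite /AWlead; ring.
Qed.

(** * The 4phi3 eigenfunction for [theta_M] and its weight *)

Section Spectrum.
Variable M : nat.
Hypothesis q_root : forall n : nat, (0 < n)%N -> q ^+ n != 1.
Hypothesis den : denominators_nonzero P.
Hypothesis le_MN : (M <= N)%N.

Local Notation y1 := (Rlow1 P LDia LDot LStar).
Local Notation y2 := (Rlow2 P LDia LDot LStar).

(** [R_m(theta_M)] is read as a function of the grid index [m] with [M] fixed: the two shifted
    factorials depending on [m] form [psi n], and the rest of the term is this coefficient. *)
Definition phi43_coef (n : nat) : C :=
  (qpoch (q ^ (- (2 * M%:Z))) (q ^+ 2) n * qpoch (b / c * q ^+ (2 * M)) (q ^+ 2) n) /
  (qpoch (q ^+ 2) (q ^+ 2) n * qpoch y1 (q ^+ 2) n * qpoch y2 (q ^+ 2) n *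
   qpoch (q ^ (- (2 * Ni))) (q ^+ 2) n) * q ^+ (2 * n).

Lemma qpochS x r n : qpoch x r n.+1 = qpoch x r n * (1 - x * r ^+ n) :> C.
Proof. by rewrite /qpoch big_ord_recr. Qed.

Lemma qpoch_neq0 (x r : C) n k : qpoch x r n != 0 -> (k < n)%N -> 1 - x * r ^+ k != 0.
Proof. by move=> /prodf_neq0 h lt_kn; have := h (Ordinal lt_kn) isT. Qed.

Lemma qpoch_neq0_le (x r : C) n k : qpoch x r n != 0 -> (k <= n)%N -> qpoch x r k != 0.
Proof.
move=> h le_kn; apply/prodf_neq0 => i _; apply: (qpoch_neq0 _ _ n) => //.
exact: leq_trans le_kn.
Qed.

Lemma qsqX n : q ^+ (2 * n) = qsq ^+ n.
Proof. by rewrite exprM. Qed.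

Lemma qVM (n : nat) : q ^ (- (2 * n%:Z)) = (qsq ^+ n)^-1.
Proof. by rewrite -invr_expz -PoszM -exprnP qsqX. Qed.

Lemma qsq_root n : (0 < n)%N -> 1 - qsq ^+ n != 0.
Proof. by move=> n0; rewrite subr_eq0 eq_sym -qsqX q_root // muln_gt0. Qed.

Lemma qsq_neq0 : qsq != 0. Proof. exact: expf_neq0. Qed.

Lemma qsqX_neq0 n : qsq ^+ n != 0. Proof. exact: (expf_neq0 _ qsq_neq0). Qed.

Lemma grid0_neq0 : grid0 != 0. Proof. by rewrite mulf_neq0. Qed.

Lemma aw_g3_neq0 : aw_g3 != 0.
Proof. by rewrite /aw_g3 mulf_neq0 ?qsqX_neq0 // mulf_neq0 // oppr_eq0 mulf_neq0 ?invr_eq0. Qed.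

Lemma aw_g4_neq0 : aw_g4 != 0.
Proof. by rewrite /aw_g4 mulf_neq0 // oppr_eq0 mulf_neq0 ?invr_eq0. Qed.

Lemma grid0_sqr : bl P LDia / cl P LDia = grid0 ^+ 2.
Proof. by rewrite /grid0 !clE; field; rewrite r0_neq0 bl_neq0 oner_neq0. Qed.

Lemma ktilde_low1E : - (bl P LDia * cs / b) * r0 P * q ^ (1 - 2 * Ni) = grid0 * qsq / aw_g3.
Proof.
rewrite expfzDr // expr1z qVM /grid0 /aw_g3 /qsq; field.
by rewrite oppr_eq0 bl_neq0 cl_neq0 q_neq0 -/qsq qsqX_neq0.
Qed.

Lemma ktilde_low2E : - (c * bs / cl P LDia) * r0 P * q = grid0 * qsq / aw_g4.
Proof.
rewrite /grid0 /aw_g4 /qsq !clE; field.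
by rewrite oppr_eq0 !bl_neq0 q_neq0 r0_neq0 oner_neq0.
Qed.

Lemma bcE : b / c = aw_g3 * aw_g4 / (qsq * qsq ^+ N).
Proof. by rewrite /aw_g3 /aw_g4 /qsq; field; rewrite !cl_neq0 q_neq0 -/qsq qsqX_neq0. Qed.

Lemma q_2N2 : q ^ (2 * Ni + 2) = qsq ^+ N * qsq.
Proof. by rewrite expfzDr // -PoszM -exprnP qsqX. Qed.

Lemma q_4X n : q ^+ (4 * n) = (qsq ^+ n) ^+ 2.
Proof. by rewrite -exprM -qsqX; congr (q ^+ _); rewrite [RHS]mulnC -mulnA [LHS]mulnC. Qed.

Lemma Rlow1E : y1 = grid0 * aw_g4.
Proof. by rewrite /Rlow1 /grid0 /aw_g4; ring. Qed.

Lemma Rlow2E : y2 = grid0 * aw_g3.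
Proof.
rewrite /Rlow2 (_ : q ^ (2 * Ni + 1) = Q ^+ 2 * q); last first.
  by rewrite expfzDr // expr1z -PoszM -exprnP qsqX qsqN.
by rewrite /grid0 /aw_g3 qsqN !clE; field; rewrite !bl_neq0 r0_neq0 oner_neq0.
Qed.

(** Ratio of consecutive terms, by [th M - th n = - (c/p^n) (1 - p^(n-M)) (1 - (b/c) p^(n+M))]. *)
Lemma phi43_coef_rec n : (n < N)%N -> phi43_coef n.+1 * aw_low qsq c grid0 aw_g3 aw_g4 N n =
  phi43_coef n * (th M - th n).
Proof.
move=> lt_nN.
have [_ [_ [_ [_ hR]]]] := den.
move: hR; rewrite mulf_eq0 negb_or => /andP[h1 h2].
have h1n := qpoch_neq0_le _ _ _ n h1 (ltnW lt_nN).
have h2n := qpoch_neq0_le _ _ _ n h2 (ltnW lt_nN).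
have h1s := qpoch_neq0 _ _ _ n h1 lt_nN.
have h2s := qpoch_neq0 _ _ _ n h2 lt_nN.
have hp k : qpoch (q ^+ 2) (q ^+ 2) k != 0.
  by apply/prodf_neq0 => i _; rewrite -/qsq -exprS qsq_root.
(* The lower parameter [q^(-4s)] has nonzero factorials up to index [N], as [q] is not a root of
   unity. *)
have hN k : (k < N)%N -> 1 - (qsq ^+ N)^-1 * qsq ^+ k != 0.
  move=> lt_kN; have eN := exprD qsq (N - k) k; rewrite (subnK (ltnW lt_kN)) in eN.
  rewrite (_ : 1 - _ = - (1 - qsq ^+ (N - k)) / qsq ^+ (N - k)).
    by rewrite mulf_neq0 ?oppr_eq0 ?qsq_root ?subn_gt0 // invr_eq0 qsqX_neq0.
  by rewrite eN; field; rewrite !qsqX_neq0.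
have hNp : qpoch (qsq ^+ N)^-1 qsq n != 0.
  by apply/prodf_neq0 => i _; apply: hN; apply: ltn_trans lt_nN.
rewrite /phi43_coef !qVM !qsqX !qpochS -/qsq.
rewrite -/qsq in h1n h2n h1s h2s hp.
have := hN n lt_nN; have := qsq_root n.+1 isT.
move: (hp n) hNp h1n h2n h1s h2s; rewrite Rlow1E Rlow2E.
rewrite /aw_low /aw_eig /aw_b !exprS.
rewrite bcE.
move: (cl_neq0 LDot) qsq_neq0 (qsqX_neq0 n) (qsqX_neq0 N) (qsqX_neq0 M).
move: (qpoch (qsq ^+ M)^-1 qsq n) (qpoch (_ / (qsq * _) * _) qsq n) => A1 A2.
move: (qpoch qsq qsq n) (qpoch (grid0 * aw_g4) qsq n) (qpoch (grid0 * aw_g3) qsq n)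
  (qpoch (qsq ^+ N)^-1 qsq n).
move=> B1 B2 B3 B4 c0 p0 Tn0 TN0 TM0 B10 B40 B20 B30 f1 f2 f3 f4.
have f5 : qsq ^+ N - qsq ^+ n != 0.
  apply: contra f4 => /eqP /(canRL (subrK _)); rewrite add0r => ->.
  by rewrite mulVf ?subrr.
field.
by rewrite Tn0 TN0 p0 TM0 B40 B30 B20 B10 f5 f1 f2 f3.
Qed.

(** For [M < N] the factorial of [q^(-2M)] contains a zero factor at [k = M]; for [M = N] the
    eigenvalues agree. *)
Lemma phi43_coef_last : phi43_coef N * (th M - th N) = 0.
Proof.
move: le_MN; rewrite leq_eqVlt => /orP[/eqP ->|lt_MN]; first by rewrite subrr mulr0.
rewrite /phi43_coef [qpoch _ _ N in X in X / _](bigD1 (Ordinal lt_MN)) //= qVM -/qsq.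
by rewrite mulVf ?qsqX_neq0 // subrr !mul0r.
Qed.

(** [t0 / t_m = p^-m] and [t0 t_m = (b^<>/c^<>) p^m]. *)
Lemma eigenf_RR m : eigenf qsq grid0 N phi43_coef (gridpt qsq grid0 m) = RR P LDia LDot LStar m M.
Proof.
rewrite /eigenf /RR /phi43; apply: eq_bigr => n _.
have -> : psi qsq grid0 n (gridpt qsq grid0 m) =
  qpoch (q ^ (- (2 * m%:Z))) (q ^+ 2) n *
  qpoch (bl P LDia / cl P LDia * q ^+ (2 * m)) (q ^+ 2) n.
  rewrite /psi /qpoch -big_split /=; apply: eq_bigr => k _.
  rewrite qVM qsqX -/qsq /gridpt [LHS]mulrC; congr ((1 - _) * (1 - _)).
    by rewrite /grid0; field; rewrite qsqX_neq0 r0_neq0 bl_neq0.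
  by rewrite /grid0 !clE; field; rewrite r0_neq0 bl_neq0 oner_neq0.
by rewrite /phi43_coef; ring.
Qed.

(** The nonzero denominators of [ktilde] cover [i = 0] and [N < i <= 2N]; the nonzero numerator of
    [nu] covers [1 <= i <= N]. *)
Lemma grid_generic i : (i <= N.*2)%N -> 1 - grid0 ^+ 2 * qsq ^+ i != 0.
Proof.
have [_ [_ [hnu [hk _]]]] := den.
have [_] := hnu LDia LDot LStar (or_introl erefl).
rewrite /nu mulf_eq0 negb_or => /andP[]; rewrite mulf_eq0 negb_or => /andP[h1 _] _.
move: hk; rewrite mulf_eq0 negb_or => /andP[]; rewrite mulf_eq0 negb_or => /andP[_ h2] h3.
rewrite -grid0_sqr => le_i; case: i le_i => [|i] le_i; first by rewrite expr0 mulr1.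
have [lt_iN|le_Ni] := ltnP i N.
  by have := qpoch_neq0 _ _ _ i h1 lt_iN; rewrite -/qsq -mulrA -exprS.
have := qpoch_neq0 _ _ _ (i - N)%N h2.
rewrite q_2N2 -exprSr.
rewrite -/qsq -mulrA -exprD addSn subnKC // => -> //; lia.
Qed.

(** Detailed balance: each shifted factorial of [ktilde] contributes one factor to the ratio of
    consecutive weights, matching the factors of [d]. *)
Lemma ktilde_rec m : (m < N)%N ->
  ktilde P LDia LDot LStar m.+1 * d (gridpt qsq grid0 m.+1)^-1 =
  ktilde P LDia LDot LStar m * d (gridpt qsq grid0 m).
Proof.
move=> lt_mN.
have dm := den_gridpt qsq grid0 N qsq_neq0 grid0_neq0 grid_generic m (ltnW lt_mN).
have dmS := den_gridpt qsq grid0 N qsq_neq0 grid0_neq0 grid_generic m.+1 lt_mN.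
have ds := den_gridptS qsq grid0 N qsq_neq0 grid0_neq0 grid_generic m lt_mN.
have [_ [_ [_ [hk _]]]] := den.
move: hk; rewrite mulf_eq0 negb_or => /andP[]; rewrite !mulf_eq0 !negb_or -/qsq.
move=> /andP[/andP[h1 h2] h3] h4.
have h1s := qpoch_neq0 _ _ _ m h1 lt_mN.
have h2s := qpoch_neq0 _ _ _ m h2 lt_mN.
have h3s := qpoch_neq0 _ _ _ m h3 lt_mN.
have {}h1 := qpoch_neq0_le _ _ _ m h1 (ltnW lt_mN).
have {}h2 := qpoch_neq0_le _ _ _ m h2 (ltnW lt_mN).
have {}h3 := qpoch_neq0_le _ _ _ m h3 (ltnW lt_mN).
have hp : qpoch qsq qsq m != 0 by apply/prodf_neq0 => i _; rewrite -exprS qsq_root.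
have hps : 1 - qsq * qsq ^+ m != 0 by rewrite -exprS qsq_root.
rewrite /ktilde !qpochS -/qsq.
rewrite ktilde_low1E ktilde_low2E q_2N2 grid0_sqr Rlow1E Rlow2E qVM bcE !q_4X ![_ ^+ m.+1]exprS /aw_coef.
have gridE1 : gridpt qsq grid0 m.+1 = grid0 * (qsq * qsq ^+ m) by rewrite /gridpt exprS.
rewrite gridE1 in dmS *; rewrite /gridpt in dm ds *.
rewrite ktilde_low1E in h1 h1s; rewrite ktilde_low2E in h2 h2s; rewrite q_2N2 grid0_sqr in h3 h3s.
rewrite grid0_sqr in h4.
have bc0 : (aw_g3 * aw_g4 / (qsq * qsq ^+ N)) ^+ m != 0.
  by rewrite expf_neq0 // -bcE mulf_neq0 ?invr_eq0.
move: (cl_neq0 LDot) qsq_neq0 (qsqX_neq0 m) (qsqX_neq0 N) grid0_neq0 aw_g3_neq0 aw_g4_neq0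
  => c0 p0 Tm0 TN0 t0 g30 g40.
move: (qpoch (grid0 * qsq / aw_g3) qsq m) (qpoch (grid0 * qsq / aw_g4) qsq m)
  (qpoch (grid0 ^+ 2 * (qsq ^+ N * qsq)) qsq m) (qpoch qsq qsq m) ((aw_g3 * aw_g4 / (qsq * qsq ^+ N)) ^+ m)
  h1 h2 h3 hp bc0 => B1 B2 B3 B4 B5 B10 B20 B30 B40 B50.
move: (qpoch _ qsq m) (qpoch _ qsq m) (qpoch _ qsq m) (qpoch _ qsq m) => A1 A2 A3 A4.
have e1 : grid0 ^+ 2 * (qsq * qsq ^+ m ^+ 2) - 1 != 0.
  by rewrite -opprB oppr_eq0; apply: contra ds => /eqP <-; apply/eqP; ring.
have e2 : (grid0 * (qsq * qsq ^+ m)) ^+ 2 - 1 != 0 by rewrite -opprB oppr_eq0.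
have e3 : aw_g4 - grid0 * qsq * qsq ^+ m != 0.
  rewrite (_ : _ - _ = aw_g4 * (1 - grid0 * qsq / aw_g4 * qsq ^+ m)); first exact: (mulf_neq0 g40 h2s).
  by field.
have e4 : aw_g3 - grid0 * qsq * qsq ^+ m != 0.
  rewrite (_ : _ - _ = aw_g3 * (1 - grid0 * qsq / aw_g3 * qsq ^+ m)); first exact: (mulf_neq0 g30 h1s).
  by field.
field.
by rewrite ds dm t0 TN0 h4 B50 B30 B20 B10 B40 Tm0 p0 e1 e2 g40 g30 h3s e3 e4 hps.
Qed.

Definition hgauge (k : nat) : C :=
  q ^+ (4 * k) * (bl P LDia / cl P LDia) *
    ((cl P LDia * q ^ (- (2 * k%:Z)) + r0 P * q * cs * b) /
     (bl P LDia * q ^+ (2 * k) + r0 P * q^-1 * cs * b)).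

Lemma HHS k : HH P k.+1 = HH P k * hgauge k.
Proof. by rewrite /HH big_ord_recr. Qed.

(** Up to monomial factors, [hgauge k] has numerator [1 - t_k g4] and, by [hgauge_den], denominator
    [1 - g4/t_(k+1)]. *)
Lemma hgauge_num k : 1 - gridpt qsq grid0 k * aw_g4 =
  (cl P LDia * q ^ (- (2 * k%:Z)) + r0 P * q * cs * b) * (qsq ^+ k / cl P LDia).
Proof.
rewrite qVM /gridpt /grid0 /aw_g4 !clE; field.
by rewrite !bl_neq0 r0_neq0 oner_neq0 qsqX_neq0.
Qed.

Lemma hgauge_den k : 1 - aw_g4 / gridpt qsq grid0 k.+1 =
  (bl P LDia * q ^+ (2 * k) + r0 P * q^-1 * cs * b) / (bl P LDia * qsq ^+ k).
Proof.
rewrite qsqX /gridpt exprS /grid0 /aw_g4 !clE /qsq; field.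
by rewrite -/qsq !bl_neq0 r0_neq0 oner_neq0 qsqX_neq0 q_neq0.
Qed.

Lemma hgauge_num_neq0 k : (k < N)%N -> 1 - gridpt qsq grid0 k * aw_g4 != 0.
Proof.
move=> lt_kN; have [/(_ k lt_kN)[_ _ h] _] := den.
by rewrite hgauge_num (mulf_neq0 h) // (mulf_neq0 (qsqX_neq0 k)) // invr_eq0.
Qed.

Lemma hgauge_den_neq0 k : (k < N)%N -> 1 - aw_g4 / gridpt qsq grid0 k.+1 != 0.
Proof.
move=> lt_kN; have [/(_ k lt_kN)[_ h _] _] := den.
by rewrite hgauge_den (mulf_neq0 h) // invr_eq0 (mulf_neq0 _ (qsqX_neq0 k)).
Qed.

Lemma hgaugeE k : (k < N)%N ->
  hgauge k = (1 - gridpt qsq grid0 k * aw_g4) / (1 - aw_g4 / gridpt qsq grid0 k.+1).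
Proof.
move=> lt_kN; have [/(_ k lt_kN)[_ h _] _] := den.
rewrite /hgauge hgauge_num hgauge_den q_4X; move: h.
move: (_ + r0 P * q^-1 * cs * b) (_ + r0 P * q * cs * b) => x z x0.
by field; rewrite x0 cl_neq0 bl_neq0 qsqX_neq0.
Qed.

Lemma thetaE : theta P LDot M = th M.
Proof.
rewrite /theta /thetak /aw_eig.
have -> : aw_b qsq c aw_g3 aw_g4 N = b by rewrite /aw_b -(mulrA c) -mulrA -bcE mulrC divfK.
by rewrite -invr_expz -exprnP qsqX.
Qed.

(** [r0 theta^<>_m] is [X(t_m)] because [r0 c^<> = (r0 b^<>)^-1]; the sign comes from exchanging
    node and grid point. *)
Lemma prodUE (y : 'I_N.+1 -> C) (k : 'I_N.+1) (m : nat) : (forall i, y i != 0) ->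
  q ^+ 2 + 1 != 0 ->
  prodU P (Ybar P y k) m = (- (q + q^-1))^-1 ^+ N *
    \prod_(i | i != k) (joukowsky (gridpt qsq grid0 m) - node y i).
Proof.
move=> y0 q2; rewrite /prodU prod_Ybar.
have <- : \prod_(i : 'I_N.+1 | i != k) (- (q + q^-1))^-1 = (- (q + q^-1))^-1 ^+ N.
  by rewrite prodr_const (eq_card (B := predC1 k)) // cardC1 card_ord.
rewrite -big_split /=; apply: eq_bigr => i _.
rewrite /UU /theta /thetak -invr_expz -exprnP qsqX /joukowsky /node /joukowsky /gridpt /grid0 !clE.
by field; rewrite y0 q_neq0 qsqX_neq0 r0_neq0 bl_neq0 oppr_eq0 -expr2 q2.
Qed.

(** * Assembly of the linear system *)

Section Assembly.
Variables (y : 'I_N.+1 -> C) (e : bool) (j : 'I_N.+1).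
Hypothesis y0 : forall i, y i != 0.
Hypothesis y4 : forall i, y i ^+ 4 != 1 /\ y i ^+ 4 != q ^- 2 /\ y i ^+ 4 != q ^- 4.
Hypothesis y_inj : injective (fun i => UU P (y i)).

Let z := node y.
Let s i := bb (y i ^+ 2) * y i ^ (- sgn e).
Let cfe := covec qsq grid0 N phi43_coef (ktilde P LDia LDot LStar) (HH P) e.
(** The left eigenvector paired with [w_k]; up to a factor [K / s k] these are the components of the
    solution. *)
Let F k := \sum_(m < N.+1) cfe m * (nodal z k).[joukowsky (gridpt qsq grid0 m)].

Let q2 : q ^+ 2 + 1 != 0.
Proof.
apply: contra (q_root 4 isT) => /eqP h.
have h4 : q ^+ 4 - 1 = (q ^+ 2 + 1) * (q ^+ 2 - 1) by ring.
by rewrite -subr_eq0 h4 h mul0r.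
Qed.

Let q4 : (q ^+ 2) ^+ 2 - 1 != 0.
Proof. by rewrite subr_eq0 -exprM q_root. Qed.

Let y4a i : (y i ^+ 2) ^+ 2 - 1 != 0.
Proof. by rewrite subr_eq0 -exprM; case: (y4 i). Qed.

Let y4b i : (q * y i ^+ 2) ^+ 2 - 1 != 0.
Proof.
have [_ [h _]] := y4 i; apply: contra h; rewrite subr_eq0.
have -> : (q * y i ^+ 2) ^+ 2 = q ^+ 2 * y i ^+ 4 by ring.
move/eqP=> h.
by rewrite -[y i ^+ 4](mulKf (expf_neq0 2 q_neq0)) h mulr1.
Qed.

Let y4c i : (q ^+ 2 * y i ^+ 2) ^+ 2 - 1 != 0.
Proof.
have [_ [_ h]] := y4 i; apply: contra h; rewrite subr_eq0.
have -> : (q ^+ 2 * y i ^+ 2) ^+ 2 = q ^+ 4 * y i ^+ 4 by ring.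
move/eqP=> h.
by rewrite -[y i ^+ 4](mulKf (expf_neq0 4 q_neq0)) h mulr1.
Qed.

Let generic_y i : generic qsq grid0 N (q * y i ^+ 2).
Proof.
have y20 : q * y i ^+ 2 != 0 by rewrite mulf_neq0 // expf_neq0.
rewrite /generic y20 -opprB oppr_eq0 y4b /=; apply/andP; split; apply/orP; left.
  rewrite -opprB oppr_eq0 (_ : qsq * _ = (q ^+ 2 * y i ^+ 2) ^+ 2) ?y4c // /qsq; ring.
rewrite (_ : 1 - _ = ((y i ^+ 2) ^+ 2 - 1) / (y i ^+ 2) ^+ 2).
  by rewrite (mulf_neq0 (y4a i)) // invr_eq0 !expf_neq0.
by rewrite /qsq; field; rewrite y0 q_neq0.
Qed.

Let z_inj : injective z.
Proof.
have UUz u : UU P u = joukowsky (q * u ^+ 2) / (q + q^-1) by rewrite /UU /joukowsky [(q * _)^-1]invfM.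
move=> i k; rewrite /z /node => ik; apply: y_inj.
by rewrite /= !UUz ik.
Qed.

Let s_neq0 i : s i != 0.
Proof.
rewrite /s mulf_neq0 ?expfz_neq0 // /bb.
rewrite (_ : _ - _ = ((y i ^+ 2) ^+ 2 - 1) / y i ^+ 2); last by field.
by rewrite (mulf_neq0 (y4a i)) // invr_eq0 expf_neq0.
Qed.

Lemma nodalE k x : \prod_(i | i != k) (x - z i) = (nodal z k).[x].
Proof. by rewrite /nodal horner_prod; apply: eq_bigr => i _; rewrite hornerXsubC. Qed.

(** The product in [GG] over [i <> k] is the full product of the [s i] divided by [s k]; the
    prefactors common to all [k] are collected in [K]. *)
Lemma XXE : exists K, forall k, XX P e M (Ybar P y k) = K / s k * F k.
Proof.
pose G := ((sgn e)%:~R * (q + q^-1) * q ^ (- (sgn e * (N%:Z + 1))) *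
     (if e then cs else b)) ^+ N.
pose K0 := if e then kappa P * FF P M / nu P LStar LDia LDot else FF P M.
exists (G * (\prod_i s i) * K0 * (nu P LDia LDot LStar)^-1 * (- (q + q^-1))^-1 ^+ N) => k.
have -> : XX P e M (Ybar P y k) = GG P e N (Ybar P y k) * K0 *
  \sum_(m < N.+1) (QQ P M m / (if e then HH P m else 1) * prodU P (Ybar P y k) m).
  by rewrite /XX /K0; case: e => //; under [in RHS]eq_bigr => m _ do rewrite divr1.
rewrite /GG prod_Ybar -/G [\prod_i s i](bigD1 k) //=.
have -> : \sum_(m < N.+1) (QQ P M m / (if e then HH P m else 1) * prodU P (Ybar P y k) m) =
  (nu P LDia LDot LStar)^-1 * (- (q + q^-1))^-1 ^+ N * F k.
  rewrite /F mulr_sumr; apply: eq_bigr => m _.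
  by rewrite prodUE // nodalE /QQ /cfe /covec eigenf_RR; ring.
have [_ [_ [/(_ _ _ _ (or_introl erefl))[_ nu0] _]]] := den.
by field; rewrite s_neq0 nu0.
Qed.

Lemma LLE k : LL P e y j k = s k / s j *
  ((nodal z k).[z k]^-1 * YY P e (y k) (Ybar P y j) +
   (j == k)%:R * (th 0 - d (q * y j ^+ 2) - d (q * y j ^+ 2)^-1)).
Proof.
rewrite /LL diagE // [RHS]mulrDr; congr (_ + _); last first.
  by case: eqP => [->|_]; rewrite ?mul0r ?mulr0 // divff // mul1r.
rewrite mulrA; congr (_ * _); rewrite /gg prod_Ybar -nodalE -prodfV.
congr (_ * _); last by apply: eq_bigr => i _; rewrite bb_shift0.
rewrite /s -!invr_expz invfM invrK.
by rewrite expfzMl exprz_inv -!invr_expz; ring.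
Qed.

Lemma linear_system :
  \sum_k (LL P e y j k - (j == k)%:R * theta P LDot M) * XX P e M (Ybar P y k) = 0.
Proof.
have [K hK] := XXE.
have [D [sD hD hF]] := AW_functional qsq c grid0 aw_g3 aw_g4 N qsq_neq0 grid0_neq0 (th M) phi43_coef
  phi43_coef_rec phi43_coef_last
  grid_generic (ktilde P LDia LDot LStar) hgauge (HH P) ktilde_rec hgauge_num_neq0 hgauge_den_neq0
  hgaugeE HHS e (nodal z j) (eq_leq (size_nodal z j)).
(* [w_j] is monic of degree [N], so the subtracted multiple of [phi N.+1] is the one in [Y]. *)
rewrite (nodal_lead z j) mulr1 in hD.
have w0 k : (nodal z k).[z k] != 0.
  by rewrite -nodalE; apply/prodf_neq0 => i ik; rewrite subr_eq0 eq_sym (inj_eq z_inj).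
transitivity (\sum_k (K / s j) * (D.[z k] / (nodal z k).[z k] * F k - (j == k)%:R * th M * F k)).
  apply: eq_bigr => k _; rewrite LLE hK thetaE YYE // -hD // -/z -[joukowsky (q * y k ^+ 2)]/(z k).
  have [<-|jk] := eqVneq j k.
    rewrite !mul1r.
    move: (s_neq0 j) (w0 j) => sj wj.
    by field; rewrite sj wj.
  (* Off the diagonal the multiplication part missing in [Y] is a multiple of [w_j] at the node
     [z k], hence zero. *)
  rewrite (nodal_root z j k) 1?eq_sym // !(mul0r, mulr0).
  by field; rewrite ?s_neq0 ?w0.
rewrite -mulr_sumr sumrB.
have -> : \sum_k (j == k)%:R * th M * F k = th M * F j.
  rewrite (bigD1 j) //= eqxx mul1r big1 ?addr0 // => k /negPf.
  by rewrite eq_sym => ->; rewrite !mul0r.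
rewrite -hF; apply/eqP; rewrite mulf_eq0 subr_eq0; apply/orP; right; apply/eqP.
(* After exchanging the sums, the sum over [k] at each grid point is the Lagrange interpolation of
   [D]. *)
rewrite /F; under eq_bigr => k _ do rewrite mulr_sumr.
rewrite exchange_big /=; apply: eq_bigr => m _.
rewrite -(lagrange_interpolation z D (joukowsky (gridpt qsq grid0 m)) z_inj sD) mulr_sumr.
by apply: eq_bigr => k _; rewrite mulrCA.
Qed.

End Assembly.
End Spectrum.
End Matching.

Theorem theorem4p4 (R : realType) (P : params R[i])
  (y : 'I_(two_s P).+1 -> R[i]) (M : nat) (e : bool) (j : 'I_(two_s P).+1) :
  (* q in C^*, not a root of unity; qh is a square root of q *)
  qh P != 0 ->
  (forall n : nat, (0 < n)%N -> q P ^+ n != 1) ->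
  (* nonzero parameters with r0^{-2} = b c = b^* c^* = b^<> c^<> *)
  r0 P != 0 -> (forall a, bl P a != 0) -> (forall a, cl P a != 0) ->
  (forall a, bl P a * cl P a = (r0 P) ^- 2) ->
  denominators_nonzero P ->
  (* zeta *)
  zeta P != 0 -> (zeta P) ^- 2 = bl P LDia * r0 P * q P ^+ two_s P ->
  (* standing assumption *)
  standing_assumption P ->
  (* the numbers y_1, ..., y_{2s+1} *)
  (forall i, y i != 0) ->
  (forall i, y i ^+ 4 != 1 /\ y i ^+ 4 != q P ^- 2 /\ y i ^+ 4 != q P ^- 4) ->
  injective (fun i => UU P (y i)) ->
  (M <= two_s P)%N ->
  \sum_(k < (two_s P).+1)
     (LL P e y j k - (j == k)%:R * theta P LDot M) * XX P e M (Ybar P y k) = 0.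

Proof.
move=> qh0 q_root r00 bl0 cl0 blcl den z0 zE _ y0 y4 y_inj le_MN.
have q0 : q P != 0 by exact: expf_neq0.
exact: linear_system.
Qed.
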